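(* Let $d \geq 1$ be a known fixed integer and let $p_1,\dots,p_d\in(0,1)$ be fixed (independent of $n$). For each $n>d$ consider the multi-parameter random simplicial complex $\mathbf{X}(n,\mathbf{p})$ on vertex set $[n]$ with $\mathbf{p}=(p_1,\dots,p_{n-1})$, where $p_i=0$ for $i>d$. For $1\le i\le d$ let $\hat p_i$ be the maximum likelihood estimator of $p_i$, put $W_i=W_i(n)=\binom{n}{i+1}^{1/2}(\hat p_i-p_i)$, and let $$Z_i\sim\mathcal N\Big(0,\;p_i(1-p_i)\prod_{j=1}^{i-1}p_j^{-\binom{i+1}{j+1}}\Big).$$ Then: 1. for every fixed $1\le i\le d$, $\lim_{n\to\infty}\mathbb E\{\hat p_i\}=p_i$ and $\lim_{n\to\infty}\mathrm{Var}(\hat p_i)=0$; 2. for all fixed $1\le i<j\le d$, $\lim_{n\to\infty}\mathrm{Cov}(W_i,W_j)=0$; 3. for every fixed $1\le i\le d$, $\lim_{n\to\infty}\sup_{x\in\mathbb R}\left|\mathbb P(W_i\le x)-\mathbb P(Z_i\le x)\right|=0$.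
   Context: $[n]=\{1,\dots,n\}$. Given $\mathbf p=(p_1,\dots,p_{n-1})\in[0,1]^{n-1}$, let $H$ be the random hypergraph on $[n]$ in which every singleton is present and every subset of $[n]$ of size $k+1\ge2$ is included with probability $p_k$, independently of all other subsets. The multi-parameter random simplicial complex $\mathbf X(n,\mathbf p)$ is the largest simplicial complex contained in $H$: a nonempty $s\subseteq[n]$ is a simplex iff every nonempty $t\subseteq s$ lies in $H$. A simplex with $i+1$ vertices is an $i$-simplex. A set $s\subseteq[n]$ with $|s|=i+1$ spans a hollow $i$-simplex in a complex if all nonempty proper subsets of $s$ are simplices (whether or not $s$ itself is). Let $S_i$ be the number of $i$-simplices and $H_i$ the number of sets spanning hollow $i$-simplices in $\mathbf X(n,\mathbf p)$ (so $S_i\le H_i$ and $H_1=\binom n2$). The MLE, with the paper's convention when it is not unique, is $\hat p_i=S_i/H_i$ if $H_i\neq0$ and $\hat p_i=0$ if $H_i=0$. *)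

(* Defs.v *)
From HB Require Import structures.
From mathcomp Require Import all_boot all_order all_algebra.
From mathcomp Require Import all_classical all_reals all_analysis.

Set Implicit Arguments.
Unset Strict Implicit.
Unset Printing Implicit Defensive.

Import Order.TTheory GRing.Theory Num.Theory.
Import numFieldNormedType.Exports.

Local Open Scope classical_set_scope.
Local Open Scope ring_scope.

Section Complexes.
Variable n : nat.
Implicit Types h K : {set {set 'I_n}}.

(* Largest simplicial complex contained in the hypergraph h.  Simplices are
   nonempty, so whether set0 belongs to h is irrelevant. *)
Definition largest_complex h : {set {set 'I_n}} :=
  [set s : {set 'I_n} | (s != finset.set0) &&
    [forall t : {set 'I_n}, (t != finset.set0) && (t \subset s) ==> (t \in h)]]%SET.

Definition num_simplices K (i : nat) : nat :=
  #|[set s : {set 'I_n} | (s \in K) && (#|s| == i.+1)]%SET|.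

Definition hollow K (i : nat) (s : {set 'I_n}) : bool :=
  (#|s| == i.+1) &&
    [forall t : {set 'I_n}, (t != finset.set0) && (t \proper s) ==> (t \in K)].

Definition num_hollow K (i : nat) : nat :=
  #|[set s : {set 'I_n} | hollow K i s]%SET|.

(* The likelihood of K is the product over i of
   q_i ^ S_i * (1 - q_i) ^ (H_i - S_i), with S_i := num_simplices K i and
   H_i := num_hollow K i.  It has a unique maximizer in q_i unless H_i = 0, in
   which case it does not depend on q_i and the estimator is 0 by convention. *)
Definition mle (R : realType) K (i : nat) : R :=
  if num_hollow K i == 0%N then 0
  else (num_simplices K i)%:R / (num_hollow K i)%:R.

End Complexes.

(* H is a random hypergraph on 'I_n containing every singleton and, mutually
   independently, every t with k.+1 >= 2 vertices with probability p k. *)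
Record random_hypergraph (R : realType) (p : nat -> R) (n : nat)
    (d : measure_display) (T : measurableType d) (P : probability T R)
    (H : T -> {set {set 'I_n}}) : Prop := RandomHypergraph {
  rh_singleton : forall (w : T) (v : 'I_n), [set v]%SET \in H w ;
  rh_measurable : forall t : {set 'I_n}, (1 < #|t|)%N ->
    measurable [set w | t \in H w] ;
  rh_prob : forall t : {set 'I_n}, (1 < #|t|)%N ->
    P [set w | t \in H w] = (p #|t|.-1)%:E ;
  rh_independent : forall F : {set {set 'I_n}},
    (forall t, t \in F -> (1 < #|t|)%N) ->
    P [set w | forall t, t \in F -> t \in H w] =
    (\prod_(t in F) P [set w | t \in H w])%E }.

Section Estimators.
Context (R : realType) (n : nat) (T : Type) (H : T -> {set {set 'I_n}}).

Definition phat (i : nat) : T -> R :=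
  fun w => mle R (largest_complex (H w)) i.

Definition Wstat (p : nat -> R) (i : nat) : T -> R :=
  fun w => Num.sqrt 'C(n, i.+1)%:R * (phat i w - p i).

End Estimators.

Definition limit_variance (R : realType) (p : nat -> R) (i : nat) : R :=
  p i * (1 - p i) * \prod_(1 <= j < i) p j ^- 'C(i.+1, j.+1).

(* normal_prob takes the standard deviation, not the variance. *)
Definition normal_cdf (R : realType) (v x : R) : \bar R :=
  normal_prob 0 (Num.sqrt v) `]-oo, x].

(* Main.v *)
(* Given the faces of dimension less than i, the number S_i of i-simplices is
   binomial with H_i trials and success probability p_i, where H_i is the number
   of hollow i-simplices. Hollow i-simplices on disjoint vertex sets occur
   independently, so H_i / 'C(n, i + 1) concentrates around
   q_i = prod_(1 <= j < i) p_j ^ 'C(i + 1, j + 1) by a second moment bound, and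
   H_i = 0 has exponentially small probability because [n] contains n %/ (i + 1)
   disjoint blocks of i + 1 vertices. Claim 1 follows from the conditional mean
   and variance of S_i / H_i. For claim 2, conditionally on the faces of
   dimension less than j the estimator of p_j is unbiased unless H_j = 0, so the
   covariance is at most a power of n times P(H_j = 0). For claim 3, Stein's
   method bounds the distance between the conditional distribution function of
   W_i and that of N(0, v), v = p_i (1 - p_i) / q_i, by a multiple of
   |H_i / 'C(n, i + 1) - q_i| + 'C(n, i + 1)^(-1/2), uniformly on compacts: the
   solution of Stein's equation for the half-line indicator has a Lipschitz
   derivative except for a jump, and binomial atoms are small. Monotonicity
   controls the tails. *)
Require Import Defs.
From HB Require Import structures.
From mathcomp Require Import all_boot all_order all_algebra.
From mathcomp Require Import all_classical all_reals all_analysis.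
From mathcomp Require Import ring lra zify.

Set Implicit Arguments.
Unset Strict Implicit.
Unset Printing Implicit Defensive.

Import Order.TTheory GRing.Theory Num.Theory.
Import numFieldNormedType.Exports.

Local Open Scope classical_set_scope.
Local Open Scope ring_scope.

(** * Stein's equation for the normal law *)

Lemma is_derive_MVT (R : realType) (f df : R -> R) (a b : R) : a <= b ->
  (forall x, a <= x <= b -> is_derive x 1 f (df x)) ->
  exists2 c, a <= c <= b & f b - f a = df c * (b - a).
Proof.
move=> ab fdf; have [||c] := @MVT_segment R f df a b ab.
- move=> x; rewrite in_itv /= => /andP[/ltW ax /ltW xb].
  by apply: fdf; rewrite ax xb.
- apply/continuous_in_subspaceT => x; rewrite inE/= in_itv /= => xab.
  have := fdf _ xab.
  by move=> [/derivable1_diffP/differentiable_continuous].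
- by rewrite in_itv /=; exists c.
Qed.

(** A nondecreasing function dominates its lower limit at -oo. Applied with limit 0, this yields the
    signs of the derivatives of the Mills ratio. *)
Lemma ge0_of_is_derive_ge0 (R : realType) (g dg : R -> R) (a : R) :
  (forall x, x <= a -> is_derive x 1 g (dg x)) ->
  (forall x, x <= a -> 0 <= dg x) ->
  (forall e, 0 < e -> exists x0, forall x, x <= x0 -> - e <= g x) ->
  0 <= g a.
Proof.
move=> gdg dg0 gN; apply/ler_addgt0Pr => e e0.
have [x0 hx0] := gN _ e0; pose x := Num.min x0 a.
have xa : x <= a by rewrite /x ge_min lexx orbT.
have [|c /andP[_ ca] eq] := @is_derive_MVT R g dg x a xa.
  by move=> y /andP[_ ya]; exact: gdg.
have : - e <= g x by apply: hx0; rewrite /x ge_min lexx.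
have : 0 <= g a - g x by rewrite eq mulr_ge0 ?subr_ge0 ?dg0.
lra.
Qed.

Section RealDerivationRules.
Context (R : realType).
Implicit Types (f g : R -> R) (x a b : R).

Lemma is_derive1D f g x a b : is_derive x 1 f a -> is_derive x 1 g b ->
  is_derive x 1 (fun y => f y + g y) (a + b).
Proof. exact: is_deriveD. Qed.

Lemma is_derive1B f g x a b : is_derive x 1 f a -> is_derive x 1 g b ->
  is_derive x 1 (fun y => f y - g y) (a - b).
Proof. exact: is_deriveB. Qed.

Lemma is_derive1M f g x a b : is_derive x 1 f a -> is_derive x 1 g b ->
  is_derive x 1 (fun y => f y * g y) (f x * b + g x * a).
Proof. exact: is_deriveM. Qed.

Lemma is_derive1Z f x a c : is_derive x 1 f a ->
  is_derive x 1 (fun y => c * f y) (c * a).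
Proof. exact: is_deriveZ. Qed.

Lemma is_derive1V f x a : f x != 0 -> is_derive x 1 f a ->
  is_derive x 1 (fun y => (f y)^-1) (- (f x) ^- 2 * a).
Proof. by move=> fx df; exact: is_deriveV. Qed.

Lemma is_derive1_div f g x a b :
  is_derive x 1 f a -> is_derive x 1 g b -> g x != 0 ->
  is_derive x 1 (fun y => f y / g y) ((a * g x - f x * b) / g x ^+ 2).
Proof.
move=> df dg gx; have := is_derive1M df (is_derive1V gx dg).
by move/is_derive_eq; apply; field.
Qed.

Lemma is_derive1_cst x c : is_derive x 1 (fun=> c : R) 0.
Proof. exact: is_derive_cst. Qed.

Lemma is_derive1_id x : is_derive x 1 (fun y => y) 1.
Proof. exact: is_derive_id. Qed.

End RealDerivationRules.

(** * The Mills ratio and the solution of Stein's equation for half-lines *)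

Section MillsRatio.
Context (R : realType) (v A : R) (F phi : R -> R).
Hypothesis v0 : 0 < v.
Hypothesis phi_gt0 : forall w, 0 < phi w.
Hypothesis phi_ub : forall w, phi w <= A.
Hypothesis dF : forall w : R, is_derive w 1 F (phi w).
Hypothesis dphi : forall w : R, is_derive w 1 phi (- (w / v) * phi w).
Hypothesis F_ge0 : forall w, 0 <= F w.
Hypothesis F_Ny : forall e, 0 < e -> exists x0, forall x, x <= x0 -> F x <= e.

Let phi_neq0 w : phi w != 0. Proof. by rewrite gt_eqF. Qed.

(** Mills ratio of the lower tail: distribution function over density. *)
Definition mills (w : R) : R := F w / phi w.

(* The derivatives of [mills], read off the equation M' = 1 + w M / v. *)
Definition dmills (w : R) : R := 1 + w * mills w / v.

Definition ddmills (w : R) : R := (mills w + w * dmills w) / v.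

Lemma is_derive_mills (w : R) : is_derive w 1 mills (dmills w).
Proof.
apply: is_derive_eq (is_derive1_div (dF w) (dphi w) (phi_neq0 w)) _.
by rewrite /dmills /mills; field; rewrite phi_neq0 gt_eqF.
Qed.

Lemma is_derive_dmills (w : R) : is_derive w 1 dmills (ddmills w).
Proof.
have dM := is_derive_mills w.
have d := is_derive1D (is_derive1_cst w 1)
  (is_derive1M (is_derive1M (is_derive1_id w) dM) (is_derive1_cst w v^-1)).
by apply: is_derive_eq d _; rewrite /ddmills /=; field; rewrite gt_eqF.
Qed.

Lemma mills_ge0 w : 0 <= mills w.
Proof. by rewrite divr_ge0 // ltW. Qed.

Let small_tail (e : R) : 0 < e ->
  exists x0, x0 < 0 /\ forall x, x <= x0 -> v * A <= e * - x.
Proof.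
move=> e0; exists (- (v * A / e) - 1); have A0 : 0 < A by exact: lt_le_trans (phi_gt0 0) _.
have vAe : 0 < v * A / e by rewrite divr_gt0 ?mulr_gt0.
split; first lra.
move=> x xle; rewrite -ler_pdivrMl // mulrC; lra.
Qed.

Lemma dmills_ge0 w : 0 <= dmills w.
Proof.
have [w0|w0] := leP 0 w.
  rewrite /dmills addr_ge0 // divr_ge0 ?(ltW v0) // mulr_ge0 //; exact: mills_ge0.
(* [g] increases from 0 at -oo, and [dmills] is a positive multiple of it. *)
pose g x := - v * (phi x / x) - F x.
have : 0 <= g w.
  apply: (@ge0_of_is_derive_ge0 R g (fun x => v * phi x / x ^+ 2)).
  - move=> x xw; have x0 : x != 0 by rewrite lt_eqF // (le_lt_trans xw).
    have d := is_derive1B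
      (is_derive1Z (- v) (is_derive1_div (dphi x) (is_derive1_id x) x0)) (dF x).
    by apply: is_derive_eq d _; field; rewrite x0 gt_eqF.
  - by move=> x xw; rewrite divr_ge0 ?sqr_ge0 // mulr_ge0 // ltW.
  - move=> e e0; have [x0 hx0] := F_Ny e0.
    exists (Num.min x0 w) => x; rewrite le_min => /andP[xx0 xw].
    have x_lt0 : x < 0 by exact: le_lt_trans w0.
    have := hx0 _ xx0; rewrite /g.
    have : 0 <= - v * (phi x / x).
      by rewrite mulNr oppr_ge0 pmulr_rle0 // pmulr_rle0 // invr_le0 ltW.
    lra.
rewrite /g /dmills /mills => gw.
have -> : 1 + w * (F w / phi w) / v = - w / (v * phi w) * (- v * (phi w / w) - F w).
  by field; rewrite phi_neq0 (gt_eqF v0) (lt_eqF w0).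
by rewrite mulr_ge0 // divr_ge0 ?mulr_ge0 ?oppr_ge0 // ltW.
Qed.

Lemma ddmills_ge0 w : 0 <= ddmills w.
Proof.
have [w0|w0] := leP 0 w.
  rewrite /ddmills divr_ge0 ?(ltW v0) // addr_ge0 ?mills_ge0 //.
  by rewrite mulr_ge0 ?dmills_ge0.
have den x : 0 < v + x * x by rewrite ltr_wpDr // -expr2 sqr_ge0.
(* As above, [g] increases from 0 at -oo. *)
pose g x := F x + v * ((x * phi x) / (v + x * x)).
have gw : 0 <= g w.
  apply: (@ge0_of_is_derive_ge0 R g
     (fun x => phi x * (2 * v ^+ 2 / (v + x * x) ^+ 2))).
  - move=> x xw.
    have dD := is_derive1D (is_derive1_cst x v)
      (is_derive1M (is_derive1_id x) (is_derive1_id x)).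
    have nz : v + x * x != 0 by rewrite gt_eqF.
    have d := is_derive1D (dF x) (is_derive1Z v
      (is_derive1_div (is_derive1M (is_derive1_id x) (dphi x)) dD nz)).
    apply: is_derive_eq d _.
    by field; rewrite (gt_eqF v0) (gt_eqF (den x)).
  - by move=> x xw; rewrite mulr_ge0 ?divr_ge0 ?mulr_ge0 ?sqr_ge0 // ltW.
  - move=> e e0; have [x0 [x00 hx0]] := small_tail e0.
    exists x0 => x xx0.
    have x_lt0 : x < 0 by exact: le_lt_trans x00.
    have := hx0 _ xx0; rewrite /g => hx.
    have : - e <= v * ((x * phi x) / (v + x * x)).
      rewrite mulrA ler_pdivlMr // mulNr.
      have h1 : - x * (v * phi x) <= - x * (v * A).
        by rewrite ler_pM2l ?oppr_gt0 // ler_pM2l.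
      have h2 : - x * (v * A) <= - x * (e * - x) by rewrite ler_pM2l ?oppr_gt0.
      have h3 : 0 <= e * v by rewrite mulr_ge0 ?ltW.
      lra.
    have := F_ge0 x; lra.
have -> : ddmills w = g w * ((v + w * w) / (phi w * v ^+ 2)).
  rewrite /ddmills /dmills /mills /g.
  by field; rewrite phi_neq0 (gt_eqF v0) (gt_eqF (den w)).
by rewrite mulr_ge0 // divr_ge0 ?mulr_ge0 ?sqr_ge0 // ltW.
Qed.

Lemma mills_nd : {homo mills : x y / x <= y}.
Proof.
move=> x y xy; have [|c _ eq] := @is_derive_MVT R mills dmills x y xy.
  by move=> z _; exact: is_derive_mills.
by rewrite -subr_ge0 eq mulr_ge0 ?subr_ge0 ?dmills_ge0.
Qed.

Lemma dmills_nd : {homo dmills : x y / x <= y}.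
Proof.
move=> x y xy; have [|c _ eq] := @is_derive_MVT R dmills ddmills x y xy.
  by move=> z _; exact: is_derive_dmills.
by rewrite -subr_ge0 eq mulr_ge0 ?subr_ge0 ?ddmills_ge0.
Qed.

(** Both [mills] and [dmills] are nondecreasing, and the term [w * dmills w] is nonpositive for
    [w < 0]. The ratio is unbounded at +oo, hence the cut-off [K]. *)
Lemma ddmills_ub K w : 0 <= K -> w <= K ->
  ddmills w <= (mills K + K * dmills K) / v.
Proof.
move=> K0 wK; rewrite ler_pM2r ?invr_gt0 // lerD ?mills_nd //.
have [w0|w0] := leP 0 w; first by rewrite ler_pM ?dmills_ge0 ?dmills_nd.
apply: (@le_trans _ _ 0); last by rewrite mulr_ge0 ?dmills_ge0.
by rewrite mulr_le0_ge0 ?dmills_ge0 // ltW.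
Qed.

Lemma mills_lipschitz K a b : a <= b -> b <= K ->
  `|mills b - mills a| <= dmills K * (b - a).
Proof.
move=> ab bK; have [|c /andP[ac cb] eq] := @is_derive_MVT R mills dmills a b ab.
  by move=> z _; exact: is_derive_mills.
have cK : c <= K by exact: le_trans bK.
rewrite eq normrM (ger0_norm (dmills_ge0 _)) ger0_norm ?subr_ge0 //.
by rewrite ler_wpM2r ?subr_ge0 ?dmills_nd.
Qed.

(** Two uses of the mean value theorem allow the derivative to be taken at any [c] in the interval;
    the binomial Stein identity needs it at both ends. *)
Lemma mills_taylor K a b c : 0 <= K -> a <= b -> b <= K -> a <= c <= b ->
  `|mills b - mills a - (b - a) * dmills c|
    <= (mills K + K * dmills K) / v * (b - a) ^+ 2.
Proof.
move=> K0 ab bK /andP[ac cb].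
have [|e /andP[ae eb] eq] := @is_derive_MVT R mills dmills a b ab.
  by move=> z _; exact: is_derive_mills.
have dd x y : a <= x -> x <= y -> y <= b -> `|dmills y - dmills x| <=
    (mills K + K * dmills K) / v * (b - a).
  move=> ax xy yb; have [|z /andP[xz zy] ->] := @is_derive_MVT R dmills ddmills x y xy.
    by move=> z _; exact: is_derive_dmills.
  have zK : z <= K by rewrite (le_trans zy) // (le_trans yb).
  rewrite normrM (ger0_norm (ddmills_ge0 _)) ger0_norm ?subr_ge0 //.
  apply: ler_pM; rewrite ?ddmills_ge0 ?subr_ge0 ?ddmills_ub //.
  by lra.
have -> : mills b - mills a - (b - a) * dmills c = (dmills e - dmills c) * (b - a).
  by rewrite eq; ring.
rewrite normrM (ger0_norm (_ : 0 <= b - a)) ?subr_ge0 // expr2 mulrA.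
apply: ler_wpM2r; first by rewrite subr_ge0.
by have [ce|/ltW ec] := leP c e; [|rewrite distrC]; apply: dd.
Qed.

Hypothesis F_le1 : forall w, F w <= 1.
Hypothesis phi_even : forall w, phi (- w) = phi w.
Hypothesis F_sym : forall w, F (- w) = 1 - F w.

(** The upper tail [1 - F w] is written as [F (- w)], so that one Mills ratio serves on both sides
    of [x]. *)
Definition stein_sol (x w : R) : R :=
  (if w <= x then (1 - F x) * mills w else F x * mills (- w)) / v.

(** At the corner [w = x] this is the left derivative, which agrees with the indicator of [w <= x]
    in Stein's equation. *)
Definition dstein_sol (x w : R) : R :=
  (if w <= x then (1 - F x) * dmills w else - (F x * dmills (- w))) / v.

(** Each branch reduces to the equation M' = 1 + w M / v of the Mills ratio. *)
Lemma stein_equation x w :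
  v * dstein_sol x w - w * stein_sol x w = (w <= x)%R%:R - F x.
Proof.
rewrite /stein_sol /dstein_sol; case: (w <= x) => /=; rewrite /dmills;
  by field; rewrite gt_eqF.
Qed.

(** The Mills ratio is only evaluated at [w <= x] or at [- w < - x], hence below [K], which makes
    [C] uniform in [x]. The solution is continuous, so the Lipschitz bound holds across [x]; its
    derivative jumps there, so the quadratic bound requires an interval on one side of [x]. *)
Lemma stein_sol_bounds K : 0 <= K -> exists2 C : R, 0 <= C &
  forall x, - K <= x <= K ->
  [/\ forall w, `|dstein_sol x w| <= C,
      forall a b, a <= b ->
        `|stein_sol x b - stein_sol x a| <= C * (b - a) &
      forall a b c, a <= c <= b -> b <= x \/ x < a ->
        `|stein_sol x b - stein_sol x a - (b - a) * dstein_sol x c|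
          <= C * (b - a) ^+ 2].
Proof.
move=> K0; pose C1 := dmills K; pose C2 := (mills K + K * dmills K) / v.
have C10 : 0 <= C1 by exact: dmills_ge0.
have C20 : 0 <= C2.
  rewrite /C2 divr_ge0 ?(ltW v0) // addr_ge0 ?mills_ge0 //.
  by rewrite mulr_ge0 ?dmills_ge0.
have vi0 : 0 <= v^-1 by rewrite invr_ge0 ltW.
pose C := (C1 + C2) / v.
have C1C : C1 / v <= C by rewrite ler_wpM2r // lerDl.
have C2C : C2 / v <= C by rewrite ler_wpM2r // lerDr.
exists C; first by rewrite mulr_ge0 // addr_ge0.
move=> x /andP[Kx xK].
have Fx0 := F_ge0 x; have Fx1 := F_le1 x.
have G0 : 0 <= 1 - F x by lra.
have nx : `|1 - F x| <= 1 by rewrite ger0_norm //; lra.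
have ny : `|F x| <= 1 by rewrite ger0_norm.
have scale (y z C' : R) : `|y| <= 1 -> `|z| <= C' -> `|y * z| <= C'.
  by move=> y1 zC; rewrite normrM -[C']mul1r ler_pM.
have divv (z C' : R) : `|z| <= C' -> `|z / v| <= C' / v.
  by move=> zC; rewrite normrM (ger0_norm vi0) ler_wpM2r.
have lip a b : a <= b -> b <= x \/ x <= a ->
    `|stein_sol x b - stein_sol x a| <= C1 / v * (b - a).
  move=> ab; have C1v : C1 / v * (b - a) = C1 * (b - a) / v by rewrite mulrAC.
  case=> [bx|xa].
    rewrite /stein_sol bx (le_trans ab bx) -mulrBl -mulrBr C1v divv // scale //.
    by rewrite mills_lipschitz // (le_trans bx).
  (* The two branches of the solution agree at [x]. *)
  have rE w : x <= w -> stein_sol x w = F x * mills (- w) / v.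
    rewrite /stein_sol; have [wx xw|//] := leP w x.
    have -> : w = x by apply/le_anti; rewrite wx xw.
    by rewrite /mills F_sym phi_even; congr (_ / _); ring.
  rewrite !rE // ?(le_trans xa) // -mulrBl -mulrBr C1v divv // scale // distrC.
  have -> : b - a = - a - - b by ring.
  apply: mills_lipschitz; lra.
split.
- move=> w; rewrite /dstein_sol; apply: (le_trans _ C1C); apply: divv.
  case: (leP w x) => wx; rewrite ?normrN; apply: scale => //;
    rewrite ger0_norm ?dmills_ge0 ?dmills_nd //; lra.
- move=> a b ab; have key : `|stein_sol x b - stein_sol x a| <= C1 / v * (b - a).
    have [bx|xb] := leP b x; first by apply: lip; auto.
    have [xa|ax] := leP x a; first by apply: lip; auto.
    (* An interval straddling [x] is cut at [x]. *)
    have := lip a x (ltW ax) (or_introl (lexx x)).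
    have := lip x b (ltW xb) (or_intror (lexx x)).
    have := ler_normD (stein_sol x b - stein_sol x x) (stein_sol x x - stein_sol x a).
    rewrite addrA subrK; lra.
  by apply: (le_trans key); rewrite ler_wpM2r // subr_ge0.
- move=> a b c /andP[ac cb] abx; have ab := le_trans ac cb.
  suff : `|stein_sol x b - stein_sol x a - (b - a) * dstein_sol x c|
      <= C2 * (b - a) ^+ 2 / v.
    move=> /le_trans; apply; rewrite mulrAC ler_wpM2r // exprn_ge0 //; lra.
  case: abx => [bx|xa].
    rewrite /stein_sol /dstein_sol bx (le_trans ab bx) (le_trans cb bx).
    rewrite [X in `|X|](_ : _ =
      (1 - F x) * (mills b - mills a - (b - a) * dmills c) / v); last ring.
    by rewrite divv // scale // mills_taylor ?ac ?cb // (le_trans bx).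
  rewrite /stein_sol /dstein_sol ![_ <= x]leNgt xa (lt_le_trans xa ac) (lt_le_trans xa ab) /=.
  rewrite [X in `|X|](_ : _ = - F x *
   (mills (- a) - mills (- b) - (- a - - b) * dmills (- c)) / v); last ring.
  rewrite divv // scale ?normrN //.
  have -> : b - a = - a - - b by ring.
  rewrite mills_taylor //; lra.
Qed.

End MillsRatio.

(** * The distribution function of a centred normal law *)

Section NormalCdf.
Context (R : realType) (s : R).
Hypothesis s0 : 0 < s.
Let mu := @lebesgue_measure R.
Let phi : R -> R := normal_pdf 0 s.

Definition ncdf (x : R) : R := fine (normal_prob 0 s `]-oo, x]).

Let sn0 : s != 0. Proof. by rewrite gt_eqF. Qed.

Let phiE w : phi w = normal_peak s * expR (- w ^+ 2 / (s ^+ 2 *+ 2)).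
Proof. by rewrite /phi normal_pdfE // /normal_fun subr0. Qed.

Lemma normal_pdf_gt0 w : 0 < normal_pdf 0 s w.
Proof. by rewrite -/phi phiE mulr_gt0 ?normal_peak_gt0 ?expR_gt0. Qed.

Lemma normal_pdf_even w : normal_pdf 0 s (- w) = normal_pdf 0 s w.
Proof. by rewrite -/phi !phiE sqrrN. Qed.

Lemma is_derive_normal_pdf (w : R) :
  is_derive w 1 (normal_pdf 0 s) (- (w / s ^+ 2) * normal_pdf 0 s w).
Proof.
have -> : normal_pdf 0 s = fun y => normal_peak s *
    (expR \o (fun y => (- (s ^+ 2 *+ 2)^-1) * (y * y))) y.
  apply/funext => y; rewrite -/phi phiE /= -expr2; congr (_ * expR _); ring.
have d := is_derive1Z (- (s ^+ 2 *+ 2)^-1)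
  (is_derive1M (is_derive1_id w) (is_derive1_id w)).
have dexp := is_derive1Z (normal_peak s) (is_derive1_comp (is_derive_expR _) d).
apply: is_derive_eq dexp _ => /=.
rewrite mulr2n; field.
by rewrite sn0 gt_eqF // addr_gt0 ?exprn_gt0.
Qed.

Lemma ncdfE x : (ncdf x)%:E = normal_prob 0 s `]-oo, x].
Proof. by rewrite fineK // fin_num_measure. Qed.

Lemma ncdf_ge0 x : 0 <= ncdf x.
Proof. by rewrite fine_ge0. Qed.

Lemma ncdf_le1 x : ncdf x <= 1.
Proof. by rewrite -lee_fin ncdfE probability_le1. Qed.

Lemma is_derive_ncdf (w : R) : is_derive w 1 ncdf (normal_pdf 0 s w).
Proof.
have -> : ncdf = fun x => (\int[mu]_(t in `]-oo, x]) phi t)%R by [].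
have [||||dF dE] := @continuous_FTC1 R phi -oo%O w (w + 1).
- lra.
- apply: (integrableS measurableT) => //.
  exact: integrable_normal_pdf.
- by rewrite ltNyr.
- exact: continuous_normal_pdf.
rewrite -[normal_pdf _ _ _]dE derive1E; exact: derivableP.
Qed.

(** Under [normal_prob 0 s] the identity is a random variable whose distribution function is [ncdf];
    this gives the limits of [ncdf] at both infinities. *)
Let idR : measurableTypeR R -> R := idfun.

#[local] HB.instance Definition _ :=
  @isMeasurableFun.Build _ _ _ _ idR (@measurable_id _ _ setT).

Let cdfE : cdf (idR : {RV (normal_prob 0 s) >-> R}) = EFin \o ncdf.
Proof. by apply/funext => x; rewrite /= ncdfE. Qed.

Lemma ncdf_Ny (e : R) : 0 < e -> exists x0, forall x, x <= x0 -> ncdf x <= e.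
Proof.
move=> e0.
have := cvg_cdfNy0 (idR : {RV (normal_prob 0 s) >-> R}).
rewrite cdfE => /fine_cvgP [_] /cvgrPdist_le /(_ e e0) [x0 [_ hx0]].
exists (x0 - 1) => x xx0.
have /hx0 : x < x0 by lra.
by rewrite /= sub0r normrN ger0_norm // ncdf_ge0.
Qed.

Lemma ncdf_y (e : R) : 0 < e ->
  exists x0, forall x, x0 <= x -> 1 - e <= ncdf x.
Proof.
move=> e0.
have := cvg_cdfy1 (idR : {RV (normal_prob 0 s) >-> R}).
rewrite cdfE => /fine_cvgP [_] /cvgrPdist_le /(_ e e0) [x0 [_ hx0]].
exists (x0 + 1) => x xx0.
have /hx0 : x0 < x by lra.
by rewrite /= ger0_norm ?subr_ge0 ?ncdf_le1 //; lra.
Qed.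

(** The density is even, so [ncdf y + ncdf (- y)] has derivative 0; its constant value is 1 by
    letting [y] grow. *)
Lemma ncdfN x : ncdf (- x) = 1 - ncdf x.
Proof.
pose g y := ncdf y + ncdf (- y).
have gc y : g x = g y.
  apply: is_derive_0_is_cst => z.
  have dN := is_derive1Z (-1) (is_derive1_id z).
  have dF := is_derive1_comp (is_derive_ncdf (-1 * z)) dN.
  have -> : g = fun y => ncdf y + (ncdf \o (fun y => -1 * y)) y.
    by apply/funext => y' /=; rewrite mulN1r.
  apply: is_derive_eq (is_derive1D (is_derive_ncdf z) dF) _.
  by rewrite /= mulN1r normal_pdf_even; ring.
suff : g x = 1 by rewrite /g; lra.
apply/eqP; rewrite -subr_eq0 -normr_le0; apply/ler_addgt0Pr => e e0.
have [x0 h0] := ncdf_Ny e0; have [x1 h1] := ncdf_y e0.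
pose y := Num.max (- x0) x1.
have : ncdf (- y) <= e by apply: h0; rewrite lerNl /y le_max lexx.
have : 1 - e <= ncdf y by apply: h1; rewrite /y le_max lexx orbT.
have := ncdf_le1 y; have := ncdf_ge0 (- y).
by rewrite (gc y) /g => ????; rewrite add0r ler_norml; lra.
Qed.

Lemma ncdf_nd : {homo ncdf : x y / x <= y}.
Proof.
move=> x y xy; have [|c _ eq] := @is_derive_MVT R ncdf (normal_pdf 0 s) x y xy.
  by move=> z _; exact: is_derive_ncdf.
by rewrite -subr_ge0 eq mulr_ge0 ?subr_ge0 // ltW // normal_pdf_gt0.
Qed.

(** Hides the formula of the solution: the binomial approximation relies on these four properties
    alone. *)
Lemma normal_stein K : 0 <= K -> exists2 C : R, 0 <= C &
  forall x, - K <= x <= K -> exists f df : R -> R,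
  [/\ forall w, s ^+ 2 * df w - w * f w = (w <= x)%R%:R - ncdf x,
      forall w, `|df w| <= C,
      forall a b, a <= b -> `|f b - f a| <= C * (b - a) &
      forall a b c, a <= c <= b -> b <= x \/ x < a ->
        `|f b - f a - (b - a) * df c| <= C * (b - a) ^+ 2].
Proof.
move=> K0; have v0 : 0 < s ^+ 2 by rewrite exprn_gt0.
have ub w : normal_pdf 0 s w <= normal_peak s by exact: normal_pdf_ub.
have [C C0 hC] := stein_sol_bounds v0 normal_pdf_gt0 ub is_derive_ncdf
  is_derive_normal_pdf ncdf_ge0 ncdf_Ny ncdf_le1 normal_pdf_even ncdfN K0.
exists C => // x xK; have [h1 h2 h3] := hC x xK.
exists (stein_sol (s ^+ 2) ncdf (normal_pdf 0 s) x).
exists (dstein_sol (s ^+ 2) ncdf (normal_pdf 0 s) x).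
by split => // w; exact: stein_equation.
Qed.

End NormalCdf.

(** * Binomial laws *)

Section BinomialExpectation.
Context (R : realType) (p : R).
Hypothesis p01 : 0 <= p <= 1.

(* Expectation under the binomial law of parameters [m] and [p]; the recursion
   adds one Bernoulli trial, which avoids binomial coefficients. *)
Fixpoint binE (m : nat) (g : nat -> R) : R :=
  if m is m'.+1 then binE m' (fun k => p * g k.+1 + (1 - p) * g k) else g 0%N.

Lemma binES m g : binE m.+1 g = binE m (fun k => p * g k.+1 + (1 - p) * g k).
Proof. by []. Qed.

Lemma eq_binE m g g' : g =1 g' -> binE m g = binE m g'.
Proof. by move=> /funext ->. Qed.

Lemma binE_lin m a b g g' :
  binE m (fun k => a * g k + b * g' k) = a * binE m g + b * binE m g'.
Proof.
elim: m g g' => //= m IH g g'; rewrite -IH; apply: eq_binE => k; ring.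
Qed.

Lemma binE_cst m c : binE m (fun=> c) = c.
Proof.
elim: m => //= m IH; rewrite -[RHS]IH; apply: eq_binE => k; ring.
Qed.

Lemma le_binE m g g' : (forall k, (k <= m)%N -> g k <= g' k) ->
  binE m g <= binE m g'.
Proof.
elim: m g g' => [|m IH] g g' gg' /=; first exact: gg'.
apply: IH => k km; case/andP: p01 => p0 p1.
by apply: lerD; apply: ler_wpM2l; rewrite ?subr_ge0 ?gg' // leqW.
Qed.

Lemma binEZ m a g : binE m (fun k => a * g k) = a * binE m g.
Proof.
have := binE_lin m a 0 g g; rewrite mul0r addr0 => <-; apply: eq_binE => k; ring.
Qed.

Lemma binED m g g' : binE m (fun k => g k + g' k) = binE m g + binE m g'.
Proof.
have := binE_lin m 1 1 g g'; rewrite !mul1r => <-; apply: eq_binE => k; ring.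
Qed.

Lemma binEB m g g' : binE m (fun k => g k - g' k) = binE m g - binE m g'.
Proof.
have := binE_lin m 1 (-1) g g'; rewrite mulN1r mul1r => <-.
by apply: eq_binE => k; ring.
Qed.

Lemma ler_norm_binE m g : `|binE m g| <= binE m (fun k => `|g k|).
Proof.
rewrite ler_norml -mulN1r -binEZ; apply/andP; split; apply: le_binE => k _.
  by rewrite mulN1r lerNl ler_normr lexx orbT.
exact: ler_norm.
Qed.

(** Stein's identity for the binomial law, a discrete integration by parts. The increment on the
    right is averaged over one trial less. *)
Lemma binE_stein m g :
  binE m.+1 (fun k => (k%:R - m.+1%:R * p) * g k) =
  m.+1%:R * p * (1 - p) * binE m (fun k => g k.+1 - g k).
Proof.
elim: m g => [|m IH] g; first by rewrite /=; ring.
rewrite [LHS]binES.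
(* Averaging over the added trial leaves the centred count of the other trials, plus [p * (1 - p)]
   times the increment of [g]. *)
rewrite (eq_binE _ (g' := fun k => 1 * ((k%:R - m.+1%:R * p) *
   (p * g k.+1 + (1 - p) * g k)) + p * (1 - p) * (g k.+1 - g k))); last first.
  by move=> k; rewrite -!natr1; ring.
rewrite binE_lin IH mul1r.
have -> : binE m (fun k => (p * g k.+2 + (1 - p) * g k.+1) -
    (p * g k.+1 + (1 - p) * g k)) = binE m.+1 (fun k => g k.+1 - g k).
  by rewrite [RHS]binES; apply: eq_binE => k; ring.
by rewrite -!natr1; ring.
Qed.

Lemma binE_centered m : binE m (fun k => k%:R - m%:R * p) = 0.
Proof.
case: m => [|m]; first by rewrite /=; ring.
have := binE_stein m (fun=> 1); rewrite subrr binE_cst mulr0 => <-.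
by apply: eq_binE => k; rewrite mulr1.
Qed.

Lemma binE_variance m :
  binE m (fun k => (k%:R - m%:R * p) ^+ 2) = m%:R * p * (1 - p).
Proof.
case: m => [|m]; first by rewrite /=; ring.
have := binE_stein m (fun k => k%:R - m.+1%:R * p).
rewrite (eq_binE m (g' := fun=> 1)) ?binE_cst ?mulr1; last first.
  by move=> k; rewrite -natr1; ring.
by move=> <-; apply: eq_binE => k; rewrite expr2.
Qed.

(* Stein's identity applied to a monotone step function bounds the probability
   of the position of its jump. *)
Lemma binE_step m (g : nat -> R) : 0 < p < 1 -> (forall k, 0 <= g k <= 1) ->
  binE m (fun k => g k.+1 - g k) <= (Num.sqrt (m.+1%:R * p * (1 - p)))^-1.
Proof.
move=> /andP[p0 p1] g01; set V := m.+1%:R * p * (1 - p).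
have V0 : 0 < V by rewrite !mulr_gt0 ?ltr0n ?subr_gt0.
set c := Num.sqrt V; have c0 : 0 < c by rewrite sqrtr_gt0.
have cV : c ^+ 2 = V by rewrite sqr_sqrtr // ltW.
have : V * binE m (fun k => g k.+1 - g k) <= c.
  rewrite -binE_stein.
  (* The inequality |t| <= t^2 / (2 c) + c / 2, with [c] the standard deviation, replaces
     Cauchy-Schwarz. *)
  apply: (@le_trans _ _ (binE m.+1 (fun k =>
     (2 * c)^-1 * (k%:R - m.+1%:R * p) ^+ 2 + c / 2 * 1))).
    apply: le_binE => k _; set t := k%:R - _; have /andP[g0 g1] := g01 k.
    have tg : t * g k <= `|t|.
      rewrite (le_trans (ler_norm _)) // normrM (ger0_norm g0).
      by rewrite ler_piMr.
    have : 0 <= (`|t| - c) ^+ 2 / (2 * c).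
      by rewrite divr_ge0 ?sqr_ge0 ?mulr_ge0 ?ltW.
    have -> : (`|t| - c) ^+ 2 / (2 * c) =
        (2 * c)^-1 * t ^+ 2 + c / 2 * 1 - `|t|.
      by rewrite -(real_normK (num_real t)); field; rewrite gt_eqF.
    lra.
  rewrite binE_lin binE_variance binE_cst -/V -cV.
  by rewrite le_eqVlt; apply/orP; left; apply/eqP; field; rewrite gt_eqF.
by rewrite -ler_pdivlMl // -cV expr2 invfM mulrVK ?unitfE ?gt_eqF // mulrC.
Qed.

End BinomialExpectation.

(** Stein's equation is averaged over the binomial law and [binE_stein] turns the term [w * f w]
    into a difference quotient of [f]. The three errors come from the mismatch of variances, from
    Taylor's formula with step [a / m.+1], and from the single step that may cross [x]. The scale
    [a] is free because the number of trials will be random while the normalization is not. *)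
Lemma binomial_clt (R : realType) (p s K : R) : 0 < p < 1 -> 0 < s -> 0 <= K ->
  exists2 C : R, 0 <= C &
  forall x, - K <= x <= K -> forall (m : nat) (a : R), 0 < a ->
  `|binE p m.+1 (fun k => (a * (k%:R / m.+1%:R - p) <= x)%R%:R) - ncdf s x|
   <= C * (`|s ^+ 2 - a ^+ 2 * p * (1 - p) / m.+1%:R| + a / m.+1%:R
           + (Num.sqrt (m.+1%:R * p * (1 - p)))^-1).
Proof.
move=> p01 s0 K0; have [C C0 hC] := normal_stein s0 K0.
have /andP[p0 p1] := p01; have p01' : 0 <= p <= 1 by rewrite !ltW.
set v := s ^+ 2; have v0 : 0 < v by rewrite exprn_gt0.
have vC0 : 0 <= v * C by rewrite mulr_ge0 // ltW.
exists (C + v * C + 2 * v * C); first lra.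
move=> x xK m a a0; have [f [D [Deq Dub flip ftay]]] := hC x xK.
set h : R := m.+1%:R; have h0 : 0 < h by rewrite ltr0n.
pose W (k : nat) : R := a * (k%:R / h - p).
pose dl := a / h; have dl0 : 0 < dl by rewrite divr_gt0.
have WS k : W k.+1 - W k = dl by rewrite /W /dl -natr1; field; rewrite gt_eqF.
have WSle k : W k <= W k.+1 by rewrite -subr_ge0 WS ltW.
set vh := a ^+ 2 * p * (1 - p) / h.
have -> : binE p m.+1 (fun k => (W k <= x)%R%:R) - ncdf s x =
   binE p m (fun k => v * (p * D (W k.+1) + (1 - p) * D (W k)) -
      vh * ((f (W k.+1) - f (W k)) / dl)).
  rewrite -[ncdf s x](binE_cst p m.+1) -binEB.
  rewrite (eq_binE _ _ (g' := fun k =>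
    v * D (W k) + (- (a / h)) * ((k%:R - h * p) * f (W k)))); last first.
    move=> k; rewrite -Deq /v; congr (_ + _); set fw := f _; rewrite /W; field.
    by rewrite gt_eqF.
  rewrite binE_lin binE_stein binES mulrA -binE_lin; apply: eq_binE => k.
  by rewrite /vh /dl /h; field; rewrite !gt_eqF.
(* The increment of [g] is 1 exactly at the step of [W] that crosses [x], and 0 elsewhere. *)
pose g k : R := (x < W k)%R%:R.
have g01 k : 0 <= g k <= 1 by rewrite /g; case: (x < W k)%R; rewrite lexx ler01.
apply: (le_trans (ler_norm_binE p01' _ _)).
apply: (@le_trans _ _ (binE p m (fun k =>
   (C * `|v - vh| + v * C * dl) + 2 * v * C * (g k.+1 - g k)))).
  apply: le_binE => // k _; set D1 := D _; set D0 := D _; set q := _ / dl.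
  have -> : v * (p * D1 + (1 - p) * D0) - vh * q =
     (v - vh) * q + v * (p * (D1 - q) + (1 - p) * (D0 - q)) by ring.
  have q1 : `|q| <= C.
    rewrite /q normrM (ger0_norm (ltW _ : 0 <= dl^-1)) ?invr_gt0 //.
    by rewrite ler_pdivrMr // -(WS k) flip.
  have step1 : `|(v - vh) * q| <= C * `|v - vh| by rewrite normrM mulrC ler_wpM2r.
  have conv (y z c : R) : `|y| <= c -> `|z| <= c ->
      `|v * (p * y + (1 - p) * z)| <= v * c.
    move=> yc zc; rewrite normrM (gtr0_norm v0) ler_wpM2l ?(ltW v0) //.
    rewrite (le_trans (ler_normD _ _)) // !normrM (gtr0_norm p0).
    rewrite (@gtr0_norm _ (1 - p)) ?subr_gt0 //.
    have -> : c = p * c + (1 - p) * c by ring.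
    by rewrite lerD // ler_wpM2l // ?subr_ge0 ltW.
  have step2 : `|v * (p * (D1 - q) + (1 - p) * (D0 - q))| <=
      v * C * dl + 2 * v * C * (g k.+1 - g k).
    have [stay|] := boolP ((W k.+1 <= x) || (x < W k)).
      have tay c : W k <= c <= W k.+1 -> `|D c - q| <= C * dl.
        move=> Wc; have : W k.+1 <= x \/ x < W k by case/orP: stay; auto.
        move=> /(ftay _ _ _ Wc); rewrite WS => key.
        have -> : D c - q = - (f (W k.+1) - f (W k) - dl * D c) / dl.
          by rewrite /q; field; rewrite gt_eqF.
        rewrite normrM normrN (ger0_norm (ltW _ : 0 <= dl^-1)) ?invr_gt0 //.
        rewrite ler_pdivrMr //; have -> : C * dl * dl = C * dl ^+ 2 by ring.
        exact: key.
      have -> : g k.+1 - g k = 0.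
        rewrite /g; case/orP: stay => [Wx|xW].
          by rewrite !ltNge Wx (le_trans (WSle k) Wx) subrr.
        by rewrite xW (lt_le_trans xW (WSle k)) subrr.
      rewrite mulr0 addr0 -mulrA; apply: conv; apply: tay; rewrite ?lexx ?WSle //.
    (* At the crossing step only the crude bound by [2 * C] holds; [binE_step] makes the probability
       of this step small. *)
    rewrite negb_or -ltNge -leNgt => /andP[xW Wx].
    rewrite /g xW ltNge Wx subr0 mulr1.
    have Dq c : `|D c - q| <= 2 * C.
      rewrite (le_trans (ler_normB _ _)) //; have := Dub c; lra.
    have := conv _ _ _ (Dq (W k.+1)) (Dq (W k)).
    have : 0 <= v * C * dl by rewrite mulr_ge0 // ltW.
    rewrite -/D1 -/D0; lra.
  rewrite (le_trans (ler_normD _ _)) //; lra.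
rewrite binED binE_cst binEZ.
have := binE_step p01' m p01 g01; rewrite -/h; set r := (Num.sqrt _)^-1 => gr.
have r0 : 0 <= r by rewrite invr_ge0.
have vC20 : 0 <= 2 * v * C by lra.
have := ler_wpM2l vC20 gr.
have : 0 <= C * dl by rewrite mulr_ge0 // ltW.
have : 0 <= C * r by rewrite mulr_ge0.
have : 0 <= v * C * r by rewrite mulr_ge0.
have : 0 <= v * C * dl by rewrite mulr_ge0 // ltW.
have : 0 <= v * C * `|v - vh| by rewrite mulr_ge0.
rewrite -/dl; lra.
Qed.

(** * Product Bernoulli measures on sets *)

Section ProductBernoulli.
Local Open Scope ring_scope.
Context (R : realType) (U : finType) (r : U -> R).
Implicit Types (A B C D F : {set U}) (g : {set U} -> R).

(** Weight of the outcome [A] for a random subset of [U] that contains each [t] independently with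
    probability [r t]. *)
Definition bw A : R := \prod_t (if t \in A then r t else 1 - r t).

Definition bE g : R := \sum_A bw A * g A.

Lemma eq_bE g g' : g =1 g' -> bE g = bE g'.
Proof. by move=> /funext ->. Qed.

Lemma bED g g' : bE (fun A => g A + g' A) = bE g + bE g'.
Proof. by rewrite -big_split; apply: eq_bigr => A _; rewrite mulrDr. Qed.

Lemma bEZ a g : bE (fun A => a * g A) = a * bE g.
Proof. by rewrite /bE big_distrr; apply: eq_bigr => A _; rewrite /= mulrCA. Qed.

Lemma bEB g g' : bE (fun A => g A - g' A) = bE g - bE g'.
Proof.
by rewrite -mulN1r -bEZ -bED; apply: eq_bE => A; rewrite mulN1r.
Qed.

Lemma bE_sum (I : Type) (s : seq I) (P : pred I) (h : I -> {set U} -> R) :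
  bE (fun A => \sum_(i <- s | P i) h i A) = \sum_(i <- s | P i) bE (h i).
Proof.
by rewrite /bE exchange_big; apply: eq_bigr => A _; rewrite big_distrr.
Qed.

Lemma bE_exchange (h : {set U} -> {set U} -> R) :
  bE (fun B => bE (fun C => h B C)) = bE (fun C => bE (fun B => h B C)).
Proof.
rewrite /bE; under eq_bigr do rewrite big_distrr.
rewrite exchange_big; apply: eq_bigr => C _; rewrite [RHS]big_distrr.
by apply: eq_bigr => B _; rewrite /= mulrCA.
Qed.

Lemma bE_prod (a b : U -> R) :
  bE (fun A => \prod_t (if t \in A then a t else b t)) =
  \prod_t (r t * a t + (1 - r t) * b t).
Proof.
rewrite bigA_distr; apply: eq_bigr => A _; rewrite -big_split.
by apply: eq_bigr => t _ /=; case: ifP.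
Qed.

Lemma bE_cst c : bE (fun=> c) = c.
Proof.
rewrite /bE -big_distrl -[RHS]mul1r; congr (_ * _).
have := bE_prod (fun=> 1) (fun=> 1).
rewrite [RHS]big1 => [<-|t _]; last ring.
by apply: eq_bigr => A _; rewrite [X in _ * X]big1 ?mulr1 // => t _; case: ifP.
Qed.

Lemma bE_sup F : bE (fun A => (F \subset A)%:R) = \prod_(t in F) r t.
Proof.
rewrite (eq_bE (g' := fun A => \prod_t (if t \in A then 1 else (t \notin F)%:R))).
  rewrite bE_prod [RHS]big_mkcond; apply: eq_bigr => t _.
  by case: (t \in F); rewrite /=; ring.
move=> A; have [/fintype.subsetP FA|/fintype.subsetPn [t tF tA]] := boolP (F \subset A).
  rewrite big1 // => t _; case: ifPn => // tA.
  by rewrite (contra _ tA) //; exact: FA.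
by rewrite (bigD1 t) //= (negbTE tA) tF mul0r.
Qed.

(* [B] resampled by [C] outside [D]. *)
Definition merge D B C := (B :&: D) :|: (C :\: D).

Lemma bE_merge D g : bE g = bE (fun B => bE (fun C => g (merge D B C))).
Proof.
have gE A : g A = \sum_A' g A' * (A == A')%:R.
  rewrite (bigD1 A) //= eqxx mulr1 big1 ?addr0 // => A' /negbTE.
  by rewrite eq_sym => ->; rewrite mulr0.
under [RHS]eq_bE => B do under eq_bE => C do rewrite gE.
under [RHS]eq_bE => B do rewrite bE_sum.
rewrite bE_sum; apply: eq_bigr => A _.
under eq_bE => B do rewrite bEZ.
rewrite bEZ mulrC; congr (_ * _).
pose w t : R := if t \in A then r t else 1 - r t.
rewrite (eq_bE (g' := fun B => \prod_t (if t \in B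
    then (if t \in D then (t \in A)%:R else w t)
    else (if t \in D then (t \notin A)%:R else w t)))).
  rewrite bE_prod; apply: eq_bigr => t _; rewrite -/(w t) /w.
  by case: (t \in D); case: (t \in A); rewrite /=; ring.
move=> B; rewrite (eq_bE (g' := fun C => \prod_t (if t \in C
    then ((if t \in D then t \in B else true) == (t \in A))%:R
    else ((if t \in D then t \in B else false) == (t \in A))%:R))).
  rewrite bE_prod; apply: eq_bigr => t _; rewrite /w.
  by case: (t \in D); case: (t \in A); case: (t \in B); rewrite /=; ring.
move=> C; have [<-|] := eqVneq (merge D B C) A.
  rewrite big1 // => t _; rewrite !inE.
  by case: (t \in C); case: (t \in D); case: (t \in B).
move=> neq; have [t] : exists t, (t \in merge D B C) != (t \in A).
  apply/existsP; apply: contraR neq => /existsPn eq.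
  by apply/eqP/finset.setP => t; have := eq t; rewrite negbK => /eqP.
rewrite !inE => tA; rewrite (bigD1 t) //=.
move: tA; case: (t \in C); case: (t \in D); case: (t \in B); case: (t \in A);
  by rewrite //= mul0r.
Qed.

Definition depends_on D g := forall A A', A :&: D = A' :&: D -> g A = g A'.

Lemma merge_in D B C : merge D B C :&: D = B :&: D.
Proof. by apply/finset.setP => t; rewrite !inE; case: (t \in D); rewrite ?andbF ?andbT ?orbF. Qed.

Lemma merge_out D B C : merge D B C :&: ~: D = C :&: ~: D.
Proof. by apply/finset.setP => t; rewrite !inE; case: (t \in D); rewrite ?andbF ?andbT. Qed.

(** After resampling, [g] sees only the first sample and [g'] only the second. *)
Lemma bE_indep D g g' : depends_on D g -> depends_on (~: D) g' ->
  bE (fun A => g A * g' A) = bE g * bE g'.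
Proof.
move=> gD gD'; rewrite (bE_merge D) mulrC -bEZ; apply: eq_bE => B.
rewrite mulrC -bEZ; apply: eq_bE => C.
by rewrite (gD _ _ (merge_in D B C)) (gD' _ _ (merge_out D B C)).
Qed.

Lemma bE_mem x (h : bool -> R) :
  bE (fun A => h (x \in A)) = r x * h true + (1 - r x) * h false.
Proof.
rewrite (eq_bE (g' := fun A => (h true - h false) * ([set x]%SET \subset A)%:R + h false)).
  by rewrite bED bE_cst bEZ bE_sup big_set1; ring.
by move=> A; rewrite finset.sub1set; case: (x \in A); rewrite /=; ring.
Qed.

(** Induction on [S]: resampling one element [x] of [S] separately adds one Bernoulli trial,
    matching the recursion of [binE]. *)
Lemma bE_binomial (S : {set U}) p (g : nat -> R) : (forall t, t \in S -> r t = p) ->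
  bE (fun A => g #|S :&: A|) = binE p #|S| g.
Proof.
have [m] := ubnP #|S|; elim: m S g => // m IH S g Sm Sp.
have [->|[x xS]] := finset.set_0Vmem S.
  by rewrite cards0 /=; under eq_bE do rewrite finset.set0I cards0; exact: bE_cst.
rewrite (cardsD1 x) xS binES -IH; last 2 first.
- by move: Sm; rewrite (cardsD1 x) xS.
- by move=> t; rewrite !inE => /andP[_ /Sp].
have cardE A : #|S :&: A| = ((x \in A) + #|(S :\ x) :&: A|)%N.
  by rewrite (cardsD1 x) !inE xS finset.setIDAC.
rewrite (bE_merge [set x]%SET) bE_exchange; apply: eq_bE => C.
rewrite -(Sp x xS) -(bE_mem x (fun b => g (b + #|(S :\ x) :&: C|)%N)).
apply: eq_bE => B; rewrite cardE; congr (g (_ + _)).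
  by rewrite !inE eqxx andbT /= orbF.
apply: eq_card => t; rewrite !inE.
by case: (t == x); rewrite ?andbF ?andbT //=.
Qed.

Section Nonneg.
Hypothesis r01 : forall t, 0 <= r t <= 1.

Lemma bw_ge0 A : 0 <= bw A.
Proof.
apply: prodr_ge0 => t _; case/andP: (r01 t) => ? ?.
by case: ifP; rewrite ?subr_ge0.
Qed.

Lemma le_bE g g' : (forall A, g A <= g' A) -> bE g <= bE g'.
Proof. by move=> gg'; apply: ler_sum => A _; rewrite ler_wpM2l ?bw_ge0. Qed.

Lemma bE_ge0 g : (forall A, 0 <= g A) -> 0 <= bE g.
Proof. by move=> g0; rewrite -(bE_cst 0); exact: le_bE. Qed.

Lemma ler_norm_bE g : `|bE g| <= bE (fun A => `|g A|).
Proof.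
apply: le_trans (ler_norm_sum _ _ _) _; apply: ler_sum => A _.
by rewrite normrM (ger0_norm (bw_ge0 A)).
Qed.

End Nonneg.

End ProductBernoulli.

(** * Hollow simplices *)

(** By Pascal's rule, each removed point destroys at most ['C(n.-1, k)] subsets. *)
Lemma bin_sub_le n k j : ('C(n, k.+1) <= 'C(n - j, k.+1) + j * 'C(n.-1, k))%N.
Proof.
elim: j => [|j IH]; first by rewrite subn0 mul0n addn0.
apply: (leq_trans IH); rewrite mulSn addnA leq_add2r subnS.
case: (posnP (n - j)) => [->|]; first by rewrite bin0n.
case E: (n - j)%N => [//|m] _; rewrite binS /= leq_add2l.
apply: leq_bin2l; move: E; lia.
Qed.

Section Hollow.
Context (n : nat).
Implicit Types (s t : {set 'I_n}) (A h : {set {set 'I_n}}).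

Definition faces s : {set {set 'I_n}} :=
  [set t : {set 'I_n} | (t != finset.set0) && (t \proper s)]%SET.

Definition hollow_sets A (i : nat) : {set {set 'I_n}} :=
  [set s : {set 'I_n} | (#|s| == i.+1) && (faces s \subset A)]%SET.

(** Faces of a proper face are again proper faces, so membership in the hypergraph already makes all
    of them simplices. *)
Lemma hollow_largest_complex h i s :
  hollow (largest_complex h) i s = (s \in hollow_sets h i).
Proof.
rewrite inE /hollow; congr (_ && _); apply/forallP/fintype.subsetP => [H t|H t].
  rewrite inE => /andP[t0 ts]; have := H t; rewrite t0 ts inE /= => /andP[_].
  by move=> /forallP /(_ t); rewrite t0 fintype.subxx.
apply/implyP => /andP[t0 ts]; rewrite inE t0; apply/forallP => u.
apply/implyP => /andP[u0 ut]; apply: H.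
by rewrite inE u0 (sub_proper_trans ut ts).
Qed.

Lemma num_hollowE h i : num_hollow (largest_complex h) i = #|hollow_sets h i|.
Proof.
rewrite /num_hollow; congr #|pred_of_set _|; apply/finset.setP => s.
by rewrite inE hollow_largest_complex.
Qed.

Lemma num_simplicesE h i :
  num_simplices (largest_complex h) i = #|hollow_sets h i :&: h|.
Proof.
rewrite /num_simplices; congr #|pred_of_set _|; apply/finset.setP => s.
rewrite !inE; have [si|] := eqVneq #|s| i.+1; last by rewrite andbF.
rewrite andbT /=; have s0 : s != finset.set0 by rewrite -card_gt0 si.
rewrite s0; apply/forallP/andP => [H|[/fintype.subsetP H sh] t].
  split; last by have := H s; rewrite s0 fintype.subxx.
  apply/fintype.subsetP => t; rewrite inE => /andP[t0 /proper_sub ts].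
  by have := H t; rewrite t0 ts.
apply/implyP => /andP[t0 ts]; have [->//|nts] := eqVneq t s.
by apply: H; rewrite inE t0 finset.properEneq nts.
Qed.

Lemma mleE (R : realType) h i : mle R (largest_complex h) i =
  if #|hollow_sets h i| == 0%N then 0
  else #|hollow_sets h i :&: h|%:R / #|hollow_sets h i|%:R.
Proof. by rewrite /mle num_hollowE num_simplicesE. Qed.

(** A common face would be nonempty and so supply a common vertex. This is the source of
    independence. *)
Lemma faces_disjoint s t : [disjoint s & t]%B -> [disjoint faces s & faces t]%B.
Proof.
move=> st; rewrite -setI_eq0; apply/eqP/finset.setP => u; rewrite !inE.
apply/negbTE; apply/negP => /andP[/andP[u0 us] /andP[_ ut]].
have /set0Pn[x xu] := u0.
have := fintype.subsetP (proper_sub us) x xu; have := fintype.subsetP (proper_sub ut) x xu.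
by move=> xt; rewrite (disjointFl st xt).
Qed.

Lemma card_faces s i j : #|s| = i.+1 -> (j < i)%N ->
  #|[set t in faces s | #|t| == j.+1]%SET| = 'C(i.+1, j.+1).
Proof.
move=> si ji; rewrite -si -cards_draws; apply: eq_card => t; rewrite !inE.
have [tj|] := eqVneq #|t| j.+1; last by rewrite !andbF.
rewrite !andbT -card_gt0 tj /= properEcard si tj.
by rewrite !ltnS ji andbT.
Qed.

(** Bounds the number of [i.+1]-sets that meet [s], the only ones whose hollowness may be correlated
    with that of [s]. *)
Lemma card_disjoint_draws s i : #|s| = i.+1 ->
  ('C(n, i.+1) - #|[set t : {set 'I_n} | (#|t| == i.+1) && [disjoint s & t]%B]%SET|
    <= i.+1 * 'C(n.-1, i))%N.
Proof.
move=> si; rewrite leq_subLR (leq_trans (bin_sub_le n i i.+1)) // leq_add2r.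
have -> : (n - i.+1)%N = #|~: s| by rewrite -si -[X in (X - _)%N]card_ord -(cardsC s) addKn.
rewrite -cards_draws subset_leq_card //; apply/fintype.subsetP => t; rewrite !inE.
by case/andP => ts ->; rewrite disjoint_sym finset.disjoints_subset.
Qed.

End Hollow.

(** * Mean and variance of the number of hollow simplices *)

Section HollowMoments.
Context (R : realType) (p : nat -> R) (n : nat).
Hypothesis p01 : forall k, (0 < k)%N -> 0 <= p k <= 1.
Implicit Types (s t : {set 'I_n}) (A B : {set {set 'I_n}}).

(** Rate 1 on sets of at most one vertex makes vertices certain and lets all subsets follow a single
    product law. *)
Definition rate t : R := if (1 < #|t|)%N then p #|t|.-1 else 1.

Definition hollow_prob i : R := \prod_(1 <= j < i) p j ^+ 'C(i.+1, j.+1).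

Local Notation Ex := (bE rate).

Lemma rate01 t : 0 <= rate t <= 1.
Proof.
rewrite /rate; case: ifP => [t1|_]; last by rewrite ler01 lexx.
by apply: p01; move: t1; case: #|t|.
Qed.

(** The proper faces are grouped by dimension. *)
Lemma prod_faces s i : #|s| = i.+1 -> \prod_(t in faces s) rate t = hollow_prob i.
Proof.
(* The value 1 at the ends reflects that vertices are certain ([j = 0]) and that [s] is not a proper
   face of itself ([j = i]). *)
move=> si; pose G j := if (0 < j < i)%N then p j ^+ 'C(i.+1, j.+1) else 1.
have -> : hollow_prob i = \prod_(0 <= j < i.+1) G j.
  rewrite big_nat_recr //= {2}/G ltnn andbF mulr1 /hollow_prob.
  case: i si @G => [|i] _ G; first by rewrite !big_geq.
  rewrite [RHS]big_ltn // {1}/G /= mul1r; apply: eq_big_nat => j ji.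
  by rewrite /G ji.
rewrite (partition_big (fun t => inord #|t|.-1 : 'I_i.+1) xpredT) //= big_mkord.
apply: eq_bigr => j _.
have tj t : t \in faces s -> (inord #|t|.-1 == j) = (#|t| == j.+1).
  rewrite inE => /andP[t0 /proper_card]; rewrite si -card_gt0 in t0 * => ti.
  rewrite -val_eqE /= inordK; move: t0 ti; case: #|t| => //= k _ ki.
  lia.
rewrite (eq_bigl (fun t => t \in [set t in faces s | #|t| == j.+1]%SET)); last first.
  move=> t; rewrite !inE; have [tf|] := boolP (t \in faces s).
    by rewrite tj //; move: tf; rewrite inE => ->.
  by rewrite inE => /negbTE ->.
rewrite (eq_bigr (fun=> if (0 < j)%N then p j else 1)); last first.
  by move=> t; rewrite !inE => /andP[_ /eqP tj']; rewrite /rate tj'.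
rewrite prodr_const /G; have [j0|j0] := posnP j; first by rewrite expr1n.
have [ji|ij] := ltnP j i; first by rewrite -(card_faces si ji).
rewrite /= (_ : #|_| = 0%N) //; apply/eqP; rewrite cards_eq0; apply/eqP/finset.setP => t.
rewrite !inE; apply/negbTE; apply/negP => /andP[/andP[_ /proper_card ts] /eqP tj'].
by move: ts; rewrite si tj' ltnS ltnNge ij.
Qed.

Lemma Ex_faces s i : #|s| = i.+1 ->
  Ex (fun A => (faces s \subset A)%:R) = hollow_prob i.
Proof. by move=> si; rewrite bE_sup (prod_faces si). Qed.

Lemma card_hollow_setsE A i : #|hollow_sets A i|%:R =
  \sum_(s : {set 'I_n} | #|s| == i.+1) (faces s \subset A)%:R :> R.
Proof.
rewrite -sum1_card natr_sum [RHS]big_mkcond [LHS]big_mkcond /=.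
by apply: eq_bigr => s _; rewrite inE; case: (_ == _); case: (_ \subset _).
Qed.

Lemma card_sets i : #|[set s : {set 'I_n} | #|s| == i.+1]%SET| = 'C(n, i.+1).
Proof.
rewrite -[X in 'C(X, _)]card_ord -cardsT -cards_draws; apply: eq_card => s.
by rewrite !inE finset.subsetT.
Qed.

Lemma hollow_prob01 i : 0 <= hollow_prob i <= 1.
Proof.
rewrite /hollow_prob; apply/andP; split.
  rewrite big_nat_cond; apply: prodr_ge0 => j /andP[/andP[j0 _] _].
  by rewrite exprn_ge0 //; case/andP: (p01 j0).
rewrite big_nat_cond; apply: prodr_ile1 => j /andP[/andP[j0 _] _].
by case/andP: (p01 j0) => p0 p1; rewrite exprn_ge0 ?exprn_ile1.
Qed.

(** The square expands into covariances of pairs, which vanish for disjoint vertex sets and are at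
    most 1 otherwise. *)
Lemma Ex_var_hollow i :
  Ex (fun A => (#|hollow_sets A i|%:R - 'C(n, i.+1)%:R * hollow_prob i) ^+ 2)
   <= 'C(n, i.+1)%:R * (i.+1 * 'C(n.-1, i))%:R.
Proof.
set N := 'C(n, i.+1)%:R; set q := hollow_prob i.
have /andP[q0 q1] := hollow_prob01 i; rewrite -/q in q0 q1.
rewrite (eq_bE _ (g' := fun A =>
   \sum_(s : {set 'I_n} | #|s| == i.+1) \sum_(t : {set 'I_n} | #|t| == i.+1)
   ((faces s \subset A)%:R * (faces t \subset A)%:R - q * (faces s \subset A)%:R
    - q * (faces t \subset A)%:R + q * q))); last first.
  move=> A; have -> : #|hollow_sets A i|%:R - N * q =
      \sum_(s : {set 'I_n} | #|s| == i.+1) ((faces s \subset A)%:R - q).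
    rewrite card_hollow_setsE big_split /=; congr (_ + _).
    rewrite /N -card_sets -sum1_card natr_sum mulr_suml -sumrN.
    by apply: eq_big => s; rewrite ?inE // mul1r.
  rewrite expr2 mulr_suml; apply: eq_bigr => s _; rewrite mulr_sumr.
  by apply: eq_bigr => t _; ring.
rewrite bE_sum; under eq_bigr do rewrite bE_sum.
have cov s t : #|s| = i.+1 -> #|t| = i.+1 ->
   bE rate (fun A => (faces s \subset A)%:R * (faces t \subset A)%:R
     - q * (faces s \subset A)%:R - q * (faces t \subset A)%:R + q * q)
   <= (~~ [disjoint s & t]%B)%:R.
  move=> si ti; rewrite bED !bEB !bEZ bE_cst !(Ex_faces si) !(Ex_faces ti).
  rewrite (eq_bE _ (g' := fun A => (faces s :|: faces t \subset A)%:R)); last first.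
    by move=> A; rewrite finset.subUset; case: (_ \subset _); case: (_ \subset _); rewrite ?mulr1 ?mulr0.
  rewrite -/q bE_sup; have [st|st] := boolP [disjoint s & t]%B.
    have fst := faces_disjoint st.
    rewrite (eq_bigl (fun u => u \in [predU faces s & faces t])); last first.
      by move=> u; rewrite !inE.
    rewrite bigU // !(prod_faces si) !(prod_faces ti) -/q.
    by rewrite le_eqVlt; apply/orP; left; apply/eqP; rewrite /=; ring.
  have : \prod_(u in faces s :|: faces t) rate u <= 1.
    by apply: prodr_ile1 => u _; exact: rate01.
  have : 0 <= q * q by rewrite mulr_ge0.
  rewrite -[(~~ false)%:R]/(1 : R); lra.
rewrite /N -(card_sets i) -sum1_card natr_sum mulr_suml.
rewrite [leRHS](eq_bigl (fun s : {set 'I_n} => #|s| == i.+1)); last by move=> s; rewrite inE.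
apply: ler_sum => s /eqP si; rewrite mul1r.
apply: (@le_trans _ _ (\sum_(t : {set 'I_n} | #|t| == i.+1) (~~ [disjoint s & t]%B)%:R)).
  by apply: ler_sum => t /eqP ti; exact: cov.
rewrite -natr_sum ler_nat; apply: leq_trans (card_disjoint_draws si).
rewrite -(card_sets i).
rewrite -(cardsID [set t : {set 'I_n} | [disjoint s & t]%B]%SET [set t : {set 'I_n} | #|t| == i.+1]%SET).
have -> : [set t : {set 'I_n} | #|t| == i.+1]%SET :&: [set t : {set 'I_n} | [disjoint s & t]%B]%SET =
    [set t : {set 'I_n} | (#|t| == i.+1) && [disjoint s & t]%B]%SET.
  by apply/finset.setP => t; rewrite !inE.
rewrite addKn -sum1_card [leqRHS]big_mkcond [leqLHS]big_mkcond /= leq_sum // => t _.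
by rewrite !inE andbC; case: (_ == _); case: [disjoint s & t]%B.
Qed.

End HollowMoments.

(** * Conditioning on lower faces, and the absence of hollow simplices *)

Section HollowConditioning.
Context (R : realType) (p : nat -> R) (n : nat).
Hypothesis p01 : forall k, (0 < k)%N -> 0 <= p k <= 1.
Implicit Types (s t : {set 'I_n}) (A B : {set {set 'I_n}}).

Local Notation Ex := (bE (@rate R p n)).

(** At most [i] vertices means dimension less than [i]: these sets determine the hollow
    [i]-simplices. *)
Definition lower (i : nat) : {set {set 'I_n}} :=
  [set t : {set 'I_n} | (#|t| <= i)%N]%SET.

Lemma hollow_sets_lower A i : hollow_sets (A :&: lower i) i = hollow_sets A i.
Proof.
apply/finset.setP => s; rewrite !inE; have [si|//] := eqVneq #|s| i.+1.
rewrite /= finset.subsetI andb_idr // => _; apply/fintype.subsetP => t.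
by rewrite !inE => /andP[_ /proper_card]; rewrite si ltnS.
Qed.

(** An [i]-simplex has [i.+1 <= j] vertices, so conditioning on [lower j] fixes both counts that
    enter the estimator of [p i]. *)
Lemma hollow_sets_lowerS A i j : (i < j)%N ->
  hollow_sets (A :&: lower j) i :&: (A :&: lower j) = hollow_sets A i :&: A.
Proof.
move=> ij; rewrite -hollow_sets_lower -finset.setIA.
have -> : lower j :&: lower i = lower i.
  apply/finset.setIidPr/fintype.subsetP => t; rewrite !inE => /leq_trans; apply.
  exact: ltnW.
rewrite hollow_sets_lower; apply/finset.setP => s; rewrite !inE.
have [->|] := eqVneq #|s| i.+1; last by [].
by rewrite ij andbT.
Qed.

(* Resampling every set outside [lower i] does not change the hollow
   [i]-simplices, and makes each of them a simplex independently. *)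
Lemma Ex_cond i (g : {set {set 'I_n}} -> nat -> R) : (0 < i)%N ->
  Ex (fun A => g (A :&: lower i) #|hollow_sets A i :&: A|) =
  Ex (fun A => binE (p i) #|hollow_sets A i| (g (A :&: lower i))).
Proof.
move=> i0; rewrite (bE_merge _ (lower i)); apply: eq_bE => B.
have hm C : hollow_sets (merge (lower i) B C) i = hollow_sets B i.
  by rewrite -hollow_sets_lower merge_in hollow_sets_lower.
rewrite -(bE_binomial (r := @rate R p n)).
  apply: eq_bE => C; rewrite hm merge_in; congr (g _ #|pred_of_set _|).
  apply/finset.setP => s; rewrite !inE; have [si|//] := eqVneq #|s| i.+1.
  by rewrite si ltnn andbF.
move=> s; rewrite inE => /andP[/eqP si _].
by rewrite /rate si ltnS i0.
Qed.

(** Consecutive runs of [i.+1] vertices; those with [l < n %/ i.+1] are complete. *)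
Definition block i (l : nat) : {set 'I_n} :=
  [set v : 'I_n | (v %/ i.+1 == l)%N]%SET.

Lemma card_block i l : (l < n %/ i.+1)%N -> #|block i l| = i.+1.
Proof.
move=> ln; have lt (j : 'I_i.+1) : (l * i.+1 + j < n)%N.
  have : (l.+1 * i.+1 <= n)%N.
    by rewrite (leq_trans _ (leq_divM n i.+1)) // leq_mul2r ln orbT.
  have := ltn_ord j; lia.
pose f j := Ordinal (lt j).
have finj : injective f by move=> j k [] /addnI /val_inj.
rewrite -[RHS]card_ord -cardsT -(card_imset _ finj); apply: eq_card => v.
rewrite inE; apply/eqP/imsetP => [vl|[j _ ->]]; last first.
  by rewrite /= divnMDl // divn_small // addn0.
have vi : (v %% i.+1 < i.+1)%N by rewrite ltn_mod.
exists (Ordinal vi); rewrite ?inE //; apply: val_inj => /=.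
by rewrite {1}(divn_eq v i.+1) vl.
Qed.

(** Induction on [m]: the faces of the last block are subsets of it, whereas no face of an earlier
    block is, so the last factor is independent of the others. *)
Lemma Ex_no_block i m : (m <= n %/ i.+1)%N ->
  Ex (fun A => \prod_(l < m) (1 - (faces (block i l) \subset A)%:R)) =
  (1 - hollow_prob p i) ^+ m.
Proof.
elim: m => [|m IH] mn; first by under eq_bE do rewrite big_ord0; rewrite bE_cst.
rewrite exprSr -IH; last exact: ltnW.
under eq_bE do rewrite big_ord_recr.
pose D := [set t : {set 'I_n} | t \subset block i m]%SET.
rewrite (@bE_indep _ _ _ (~: D)) ?finset.setCK.
- by rewrite bEB bE_cst (Ex_faces p (card_block mn)).
- move=> A A' AA'; apply: eq_bigr => l _; congr (1 - (nat_of_bool _)%:R).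
  have sub t : t \in faces (block i l) -> t \in ~: D.
    rewrite !inE => /andP[/set0Pn[v vt] /proper_sub /fintype.subsetP tl].
    apply/negP => /fintype.subsetP /(_ _ vt); have := tl _ vt.
    by rewrite !inE => /eqP -> /eqP lm; have := ltn_ord l; rewrite lm ltnn.
  have eq A0 : (faces (block i l) \subset A0) = (faces (block i l) \subset A0 :&: ~: D).
    rewrite finset.subsetI andb_idr // => _; exact/fintype.subsetP.
  by rewrite eq AA' -eq.
- move=> A A' AA'; congr (1 - (nat_of_bool _)%:R).
  have eq A0 : (faces (block i m) \subset A0) = (faces (block i m) \subset A0 :&: D).
    rewrite finset.subsetI andb_idr // => _; apply/fintype.subsetP => t.
    by rewrite !inE => /andP[_ /proper_sub].
  by rewrite eq AA' -eq.
Qed.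

(** Without hollow [i]-simplices, none of the disjoint blocks is hollow. *)
Lemma Ex_no_hollow i :
  Ex (fun A => (#|hollow_sets A i| == 0%N)%:R)
    <= (1 - hollow_prob p i) ^+ (n %/ i.+1).
Proof.
rewrite -Ex_no_block //; apply: le_bE; first exact: rate01.
move=> A; have [/eqP h0|_] := boolP (_ == _); last first.
  by apply: prodr_ge0 => l _; rewrite subr_ge0; case: (_ \subset _).
rewrite big1 // => l _; suff -> : (faces (block i l) \subset A) = false.
  by rewrite subr0.
apply/negP => fA; have : block i l \in hollow_sets A i.
  by rewrite inE card_block ?ltn_ord // eqxx.
by move/card0_eq: h0 => ->.
Qed.

End HollowConditioning.

(** * The estimator given the number of hollow simplices *)

Section BinomialRatio.
Context (R : realType) (p q : R).
Hypotheses (p01 : 0 < p < 1) (q01 : 0 < q <= 1).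

(** The estimator as a function of the numbers [h] of hollow simplices and [k] of simplices. *)
Definition ratio (h k : nat) : R := if h == 0%N then 0 else k%:R / h%:R.

Let p01' : 0 <= p <= 1. Proof. by case/andP: p01 => *; rewrite !ltW. Qed.

(** When [h] is atypically small, including [h = 0], the deviation from [q] is so large that any
    quantity bounded by 1 is at most a multiple of it. *)
Lemma dev_ge_half (x : R) : x <= q / 2 -> 1 <= 2 / q * `|x - q|.
Proof.
case/andP: q01 => q0 _ xq; rewrite mulrAC ler_pdivlMr // mul1r.
have := ler_norm (q - x); rewrite distrC; lra.
Qed.

Lemma binE_ratio_mean h :
  binE p h (ratio h) = p - p * (h == 0%N)%:R.
Proof.
rewrite /ratio; case: (eqVneq h 0%N) => [->|h0] /=; first by rewrite mulr1 subrr.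
rewrite mulr0 subr0; have h0' : h%:R != 0 :> R by rewrite pnatr_eq0.
rewrite (eq_binE _ _ (g' := fun k => h%:R^-1 * (k%:R - h%:R * p) + p)).
  by rewrite binED binEZ binE_centered binE_cst mulr0 add0r.
by move=> k; field.
Qed.

Lemma binE_ratio_varE h : (0 < h)%N ->
  binE p h (fun k => (ratio h k - p) ^+ 2) = h%:R^-1 * (p * (1 - p)).
Proof.
move=> h0; have h0' : h%:R != 0 :> R by rewrite pnatr_eq0 -lt0n.
rewrite /ratio eqn0Ngt h0 /=.
rewrite (eq_binE _ _ (g' := fun k => (h%:R ^-2) * (k%:R - h%:R * p) ^+ 2)).
  by rewrite binEZ binE_variance; field.
by move=> k; field.
Qed.

(** If [h%:R / N] exceeds [q / 2], then [h^-1] is at most [2 / (q * N)]. This is weakened to order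
    [N^(-1/2)] so that one error term serves all estimates. *)
Lemma binE_ratio_var h (N : R) : 1 <= N ->
  binE p h (fun k => (ratio h k - p) ^+ 2)
    <= 2 / q * (`|h%:R / N - q| + (Num.sqrt N)^-1).
Proof.
case/andP: q01 => q0 _; case/andP: p01 => p0 p1 N1.
have N0 : 0 < N by lra.
have sN0 : 0 < Num.sqrt N by rewrite sqrtr_gt0.
have sN1 : 1 <= Num.sqrt N by rewrite -sqrtr1 ler_wsqrtr.
have NE : Num.sqrt N ^+ 2 = N by rewrite sqr_sqrtr // ltW.
have isN : 0 <= (Num.sqrt N)^-1 by rewrite invr_ge0 ltW.
have q2 : 0 <= 2 / q by rewrite divr_ge0 // ltW.
have pp : p * (1 - p) <= 1.
  have := mulr_ge0 (ltW p0) (ltW p0); lra.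
have pp0 : 0 <= p * (1 - p) by rewrite mulr_ge0 ?subr_ge0 // ltW.
have [low|high] := leP (h%:R / N) (q / 2).
  apply: (@le_trans _ _ 1); last first.
    by rewrite mulrDr (le_trans (dev_ge_half low)) // lerDl mulr_ge0.
  have [->|h0] := posnP h; first by rewrite /ratio /= sub0r sqrrN exprn_ile1 // ltW.
  rewrite binE_ratio_varE // (le_trans _ pp) // ler_piMl //.
  by rewrite invf_le1 ?ltr0n // ler1n.
have h0 : 0 < h%:R :> R.
  have : 0 < h%:R / N by apply: lt_trans high; rewrite divr_gt0.
  by rewrite pmulr_lgt0 ?invr_gt0.
rewrite binE_ratio_varE -?(ltr0n R) //.
apply: (@le_trans _ _ (2 / q * (Num.sqrt N)^-1)); last first.
  by rewrite ler_wpM2l // lerDr.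
apply: (@le_trans _ _ h%:R^-1); first by rewrite ler_piMr ?invr_ge0 // ltW.
move: high; rewrite ltr_pdivlMr // => high.
rewrite -[h%:R^-1]mul1r ler_pdivrMr // mulrAC ler_pdivlMr // mul1r.
rewrite mulrAC ler_pdivlMr //.
have : 0 <= q * Num.sqrt N * (Num.sqrt N - 1).
  by rewrite mulr_ge0 ?subr_ge0 // mulr_ge0 // ltW.
have : q * N = q * Num.sqrt N ^+ 2 by rewrite NE.
lra.
Qed.

Lemma zero_dev h (N : R) : 0 < N ->
  (h == 0%N)%:R <= 2 / q * (`|h%:R / N - q| + (Num.sqrt N)^-1).
Proof.
case/andP: q01 => q0 _ N0; have q2 : 0 <= 2 / q by rewrite divr_ge0 // ltW.
have isN : 0 <= (Num.sqrt N)^-1 by rewrite invr_ge0 sqrtr_ge0.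
case: (eqVneq h 0%N) => [->|_]; last by rewrite mulr_ge0 ?addr_ge0.
have low : 0%:R / N <= q / 2 by rewrite mul0r divr_ge0 // ltW.
by rewrite mulrDr (le_trans (dev_ge_half low)) // lerDl mulr_ge0.
Qed.

(** For [h%:R / N <= q / 2] the bound is trivial. Otherwise [binomial_clt] with [a = Num.sqrt N]
    applies, and [h >= q * N / 2] makes each of its three errors linear in the present one. *)
Lemma binE_ratio_clt K : 0 <= K -> exists2 C : R, 0 <= C &
  forall x, - K <= x <= K -> forall h (N : R), 0 < N ->
  `|binE p h (fun k => (Num.sqrt N * (ratio h k - p) <= x)%R%:R)
     - ncdf (Num.sqrt (p * (1 - p) / q)) x|
   <= C * (`|h%:R / N - q| + (Num.sqrt N)^-1).
Proof.
case/andP: q01 => q0 q1; case/andP: (p01) => p0 p1 K0.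
set s := Num.sqrt _; have pp0 : 0 < p * (1 - p) by rewrite mulr_gt0 ?subr_gt0.
have s0 : 0 < s by rewrite sqrtr_gt0 divr_gt0.
have s2 : s ^+ 2 = p * (1 - p) / q by rewrite sqr_sqrtr // ltW // divr_gt0.
have [C C0 hC] := binomial_clt p01 s0 K0.
(* This constant bounds the inverse binomial standard deviation times [Num.sqrt N] when
   [h >= q * N / 2]. *)
pose c := (Num.sqrt (q / 2 * (p * (1 - p))))^-1.
have c0 : 0 < c by rewrite invr_gt0 sqrtr_gt0 mulr_gt0 ?divr_gt0.
have qi0 : 0 < q^-1 by rewrite invr_gt0.
have q2 : 0 < 2 / q by rewrite divr_gt0.
have q22 : 0 < 2 / q ^+ 2 by rewrite divr_gt0 // exprn_gt0.
have S0 : 0 <= 2 / q ^+ 2 + 2 / q + c by lra.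
have CS0 := mulr_ge0 C0 S0.
exists (2 / q + C * (2 / q ^+ 2 + 2 / q + c)); first lra.
move=> x xK h N N0.
have sN0 : 0 < Num.sqrt N by rewrite sqrtr_gt0.
have NE : Num.sqrt N ^+ 2 = N by rewrite sqr_sqrtr // ltW.
have isN : 0 <= (Num.sqrt N)^-1 by rewrite invr_ge0 ltW.
set dev := `|_ / N - q|; have dev0 : 0 <= dev by exact: normr_ge0.
have [low|high] := leP (h%:R / N) (q / 2).
  have ge1 : 1 <= 2 / q * (dev + (Num.sqrt N)^-1).
    by rewrite mulrDr (le_trans (dev_ge_half low)) // lerDl mulr_ge0 // ltW.
  apply: (@le_trans _ _ 1).
    have F0 := ncdf_ge0 s x; have F1 := ncdf_le1 s x.
    set f := fun k : nat => _.
    have f01 k : 0 <= f k <= 1 by rewrite /f ler0n lern1 leq_b1.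
    have b0 : 0 <= binE p h f.
      by rewrite -(binE_cst p h 0); apply: le_binE => // k _; case/andP: (f01 k).
    have b1 : binE p h f <= 1.
      by rewrite -(binE_cst p h 1); apply: le_binE => // k _; case/andP: (f01 k).
    rewrite ler_norml; lra.
  by apply: (le_trans ge1); rewrite ler_wpM2r ?addr_ge0 // lerDl.
have h0 : 0 < h%:R :> R.
  have : 0 < h%:R / N by apply: lt_trans high; rewrite divr_gt0.
  by rewrite pmulr_lgt0 ?invr_gt0.
have := hC x xK h.-1 _ sN0.
have hS : h = h.-1.+1 by rewrite prednK // -(ltr0n R).
rewrite -hS NE s2 /ratio (_ : h == 0%N = false); last by rewrite hS.
move=> key; apply: (le_trans key).
have hN : q / 2 * N <= h%:R by move: high; rewrite ltr_pdivlMr // => /ltW.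
(* The variance mismatch factors through [h%:R / N - q], with a coefficient controlled by
   [N / h <= 2 / q]. *)
have t1 : `|p * (1 - p) / q - N * p * (1 - p) / h%:R| <= 2 / q ^+ 2 * dev.
  have -> : p * (1 - p) / q - N * p * (1 - p) / h%:R =
     (p * (1 - p) / q * (N / h%:R)) * (h%:R / N - q).
    by field; rewrite !gt_eqF.
  rewrite normrM -/dev ler_wpM2r // ger0_norm; last first.
    by rewrite mulr_ge0 // divr_ge0 // ltW.
  have -> : 2 / q ^+ 2 = 1 / q * (2 / q) by field; rewrite gt_eqF.
  apply: ler_pM; [by rewrite divr_ge0 // ltW|by rewrite divr_ge0 // ltW| |].
    rewrite ler_pM2r // -[leRHS]mulr1 ler_pM ?subr_ge0 ?ltW //; lra.
  rewrite ler_pdivrMr // mulrAC ler_pdivlMr //; lra.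
have t2 : Num.sqrt N / h%:R <= 2 / q * (Num.sqrt N)^-1.
  rewrite ler_pdivrMr // mulrAC ler_pdivlMr // -expr2 NE mulrAC ler_pdivlMr //; lra.
have t3 : (Num.sqrt (h%:R * p * (1 - p)))^-1 <= c * (Num.sqrt N)^-1.
  have qpp0 : 0 < q / 2 * (p * (1 - p)) by rewrite mulr_gt0 // divr_gt0.
  have -> : h%:R * p * (1 - p) = h%:R * (p * (1 - p)) by ring.
  rewrite /c -invfM -sqrtrM ?(ltW qpp0) // lef_pV2 ?posrE ?sqrtr_gt0 ?mulr_gt0 ?subr_gt0 //.
  by rewrite ler_wsqrtr // mulrAC ler_pM2r.
have p1' := mulr_ge0 (ltW q2) dev0; have p2' := mulr_ge0 (ltW q2) isN.
have p3' := mulr_ge0 (ltW c0) isN; have p4' := mulr_ge0 (ltW c0) dev0.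
have p5' := mulr_ge0 (ltW q22) isN.
apply: (@le_trans _ _ (C * (2 / q ^+ 2 * dev + 2 / q * (Num.sqrt N)^-1 +
    c * (Num.sqrt N)^-1))).
  by rewrite ler_wpM2l // !lerD.
rewrite [leRHS]mulrDl ler_wpDl //; first by rewrite mulr_ge0 ?addr_ge0 // ltW.
rewrite -[C * _ * _]mulrA; apply: ler_wpM2l => //.
have p6' := mulr_ge0 (ltW q22) dev0; lra.
Qed.

End BinomialRatio.

(** * Moments of the estimator *)

Section EstimatorMoments.
Context (R : realType) (p : nat -> R) (n : nat).
Hypothesis p01 : forall k, (0 < k)%N -> 0 <= p k <= 1.
Implicit Types (A : {set {set 'I_n}}).

Local Notation Ex := (bE (@rate R p n)).
Let le_Ex := le_bE (@rate01 R p n p01).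

Definition estimator i A : R := ratio R #|hollow_sets A i| #|hollow_sets A i :&: A|.

Definition deviation i A : R :=
  `|#|hollow_sets A i|%:R / 'C(n, i.+1)%:R - hollow_prob p i|
    + (Num.sqrt 'C(n, i.+1)%:R)^-1.

(** Given the number of hollow [i]-simplices, which [lower i] determines, the number of
    [i]-simplices is binomial. *)
Lemma Ex_level i (G : nat -> nat -> R) : (0 < i)%N ->
  Ex (fun A => G #|hollow_sets A i| #|hollow_sets A i :&: A|) =
  Ex (fun A => binE (p i) #|hollow_sets A i| (G #|hollow_sets A i|)).
Proof.
move=> i0; have /= cond := Ex_cond p (fun B k => G #|hollow_sets B i| k) i0.
transitivity (Ex (fun A => G #|hollow_sets (A :&: lower n i) i| #|hollow_sets A i :&: A|)).
  by apply: eq_bE => A; rewrite hollow_sets_lower.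
by rewrite cond; apply: eq_bE => A; rewrite hollow_sets_lower.
Qed.

(** The identity [n * 'C(n.-1, i) = i.+1 * 'C(n, i.+1)] turns [Ex_var_hollow] into a relative
    variance of order [1 / n], hence a mean deviation of order [n^(-1/2)]. *)
Lemma Ex_deviation i : (i < n)%N ->
  Ex (deviation i) <= 2 * i.+1%:R ^+ 2 / Num.sqrt n%:R.
Proof.
move=> i_n; rewrite bED bE_cst.
set N : R := 'C(n, i.+1)%:R; set q := hollow_prob p i.
set e := Num.sqrt n%:R; set c : R := i.+1%:R.
have N0 : 0 < N by rewrite ltr0n bin_gt0.
have n0 : 0 < n%:R :> R by rewrite ltr0n (leq_ltn_trans _ i_n).
have e0 : 0 < e by rewrite sqrtr_gt0.
have eE : e ^+ 2 = n%:R by rewrite sqr_sqrtr // ltW.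
have c1 : 1 <= c by rewrite ler1n.
have diag : n%:R * 'C(n.-1, i)%:R = c * N by rewrite -!natrM mul_bin_diag.
have var : Ex (fun A => (#|hollow_sets A i|%:R / N - q) ^+ 2) <= c ^+ 2 / n%:R.
  rewrite (eq_bE _ (g' := fun A => N^-2 * (#|hollow_sets A i|%:R - N * q) ^+ 2)).
    rewrite bEZ ler_pdivrMl ?exprn_gt0 //.
    apply: le_trans (Ex_var_hollow n p01 i) _; rewrite -/N natrM -/c.
    suff -> : 'C(n.-1, i)%:R = c * N / n%:R :> R.
      by rewrite le_eqVlt; apply/orP; left; apply/eqP; field; rewrite gt_eqF.
    by rewrite -diag; field; rewrite gt_eqF.
  by move=> A; field; rewrite gt_eqF.
have abs : Ex (fun A => `|#|hollow_sets A i|%:R / N - q|) <= c ^+ 2 / e.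
  (* Passage from the second moment to the first by |t| <= e t^2 / 2 + 1 / (2 e); the choice of [e]
     as the square root of [n] balances the two terms. *)
  apply: (@le_trans _ _ (Ex (fun A =>
      e / 2 * (#|hollow_sets A i|%:R / N - q) ^+ 2 + (2 * e)^-1))).
    apply: le_Ex => A; set t := _ - q.
    have : 0 <= (e * `|t| - 1) ^+ 2 / (2 * e).
      by rewrite divr_ge0 ?sqr_ge0 // mulr_ge0 // ltW.
    rewrite -(real_normK (num_real t)).
    have -> : (e * `|t| - 1) ^+ 2 / (2 * e) = e / 2 * `|t| ^+ 2 + (2 * e)^-1 - `|t|.
      by field; rewrite gt_eqF.
    lra.
  rewrite bED bE_cst bEZ.
  have e2 : 0 <= e / 2 by rewrite divr_ge0 // ltW.
  have := ler_wpM2l e2 var; rewrite -eE.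
  have -> : e / 2 * (c ^+ 2 / e ^+ 2) = c ^+ 2 / e / 2 by field; rewrite gt_eqF.
  have -> : (2 * e)^-1 = 1 / e / 2 by field; rewrite gt_eqF.
  have : 1 / e <= c ^+ 2 / e.
    by rewrite ler_pM2r ?invr_gt0 // expr_ge1 // (le_trans ler01).
  lra.
have sN : (Num.sqrt N)^-1 <= c ^+ 2 / e.
  rewrite -[leLHS]mul1r ler_pdivrMr ?sqrtr_gt0 // mulrAC ler_pdivlMr // mul1r.
  have c0 : 0 <= c ^+ 2 by rewrite exprn_ge0 // (le_trans ler01).
  rewrite -ler_sqr ?nnegrE ?mulr_ge0 ?sqrtr_ge0 //.
  rewrite eE exprMn sqr_sqrtr ?(ltW N0) // -exprM.
  have : n%:R <= c * N.
    by rewrite -diag ler_peMr ?(ltW n0) // ler1n bin_gt0; lia.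
  move/le_trans; apply; rewrite ler_pM2r // -[leLHS]expr1.
  by rewrite ler_weXn2l.
rewrite /q in abs *; lra.
Qed.

Lemma estimator01 i A : 0 <= estimator i A <= 1.
Proof.
rewrite /estimator /ratio; case: (eqVneq #|hollow_sets A i| 0%N) => [_|h0].
  by rewrite lexx ler01.
rewrite divr_ge0 // ler_pdivrMr ?ltr0n ?lt0n // mul1r ler_nat.
by rewrite subset_leq_card // finset.subsetIl.
Qed.

Lemma Ex_estimator i : (0 < i)%N -> Ex (estimator i) =
  p i - p i * Ex (fun A => (#|hollow_sets A i| == 0%N)%:R).
Proof.
move=> i0; rewrite (Ex_level (@ratio R)) // -bEZ -[X in X - _](bE_cst (@rate R p n)) -bEB.
by apply: eq_bE => A; rewrite binE_ratio_mean.
Qed.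

(** Conditionally on [lower j], the first factor is fixed and the estimator of [p j] has mean [p j]
    except for a bias [- p j] on the event [Z] that no hollow [j]-simplex exists. Constants
    integrate to 0 against the centred first factor, so only this bias remains. *)
Lemma Ex_estimator_cov i j : (0 < i)%N -> (i < j)%N ->
  `|Ex (fun A => (estimator i A - Ex (estimator i)) * (estimator j A - Ex (estimator j)))|
    <= Ex (fun A => (#|hollow_sets A j| == 0%N)%:R).
Proof.
move=> i0 ij; have j0 : (0 < j)%N by exact: ltn_trans ij.
set Z := fun A => (#|hollow_sets A j| == 0%N)%:R : R.
set mi := Ex (estimator i).
have mi01 : 0 <= mi <= 1.
  rewrite -{1}(bE_cst (@rate R p n) 0) -(bE_cst (@rate R p n) 1) /mi.
  by rewrite !le_Ex // => A; case/andP: (estimator01 i A).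
have -> : Ex (fun A => (estimator i A - mi) * (estimator j A - Ex (estimator j))) =
    p j * Ex (fun A => (mi - estimator i A) * Z A).
  have lower_i A : estimator i A = ratio R #|hollow_sets (A :&: lower n j) i|
      #|hollow_sets (A :&: lower n j) i :&: (A :&: lower n j)|.
    rewrite hollow_sets_lowerS // /estimator.
    rewrite -(hollow_sets_lower A i) -(hollow_sets_lower (A :&: lower n j) i).
    rewrite -finset.setIA; have -> // : lower n j :&: lower n i = lower n i.
    apply/finset.setIidPr/fintype.subsetP => t; rewrite !inE => /leq_trans; apply.
    exact: ltnW.
  pose g (B : {set {set 'I_n}}) (k : nat) : R :=
    (ratio R #|hollow_sets B i| #|hollow_sets B i :&: B| - mi) *
    (ratio R #|hollow_sets B j| k - Ex (estimator j)).
  have := Ex_cond p g j0; rewrite /g.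
  under eq_bE do rewrite -lower_i hollow_sets_lower.
  rewrite -/(estimator j _) => ->.
  under eq_bE do rewrite -lower_i hollow_sets_lower binEZ binEB binE_cst binE_ratio_mean.
  rewrite (eq_bE _ (g' := fun A => p j * ((mi - estimator i A) * Z A) +
     (p j - Ex (estimator j)) * (estimator i A - mi))); last first.
    by move=> A; rewrite /Z; ring.
  by rewrite bED !bEZ bEB bE_cst subrr mulr0 addr0.
have /andP[pj0 pj1] := p01 j0.
rewrite normrM (ger0_norm pj0).
have key : `|Ex (fun A => (mi - estimator i A) * Z A)| <= Ex Z.
  apply: le_trans (ler_norm_bE (rate01 p01) _) _; apply: le_Ex => A.
  have Z0 : 0 <= Z A by rewrite /Z.
  rewrite normrM (ger0_norm Z0) ler_piMl // ler_norml.
  have /andP[e0 e1] := estimator01 i A; have /andP[m0 m1] := mi01.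
  by apply/andP; split; lra.
by apply: le_trans key; rewrite ler_piMl.
Qed.

End EstimatorMoments.

Section EstimatorBounds.
Context (R : realType) (p : nat -> R) (i : nat).
Hypotheses (p01 : forall k, (0 < k)%N -> 0 <= p k <= 1) (i0 : (0 < i)%N).
Hypotheses (pi01 : 0 < p i < 1) (q0 : 0 < hollow_prob p i).

Let q01 : 0 < hollow_prob p i <= 1.
Proof. by rewrite q0; case/andP: (hollow_prob01 p01 i). Qed.

(** Each conditional bound is a multiple of [deviation], whose mean is given by [Ex_deviation]; [C2]
    dominates all the factors. *)
Lemma estimator_bounds K : 0 <= K -> exists2 C : R, 0 <= C &
  forall n, (i < n)%N ->
  [/\ bE (@rate R p n) (fun A => (#|hollow_sets A i| == 0%N)%:R) <= C / Num.sqrt n%:R,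
      bE (@rate R p n) (fun A => (estimator R i A - p i) ^+ 2) <= C / Num.sqrt n%:R &
      forall x, - K <= x <= K ->
      `|bE (@rate R p n) (fun A =>
          (Num.sqrt 'C(n, i.+1)%:R * (estimator R i A - p i) <= x)%R%:R)
        - ncdf (Num.sqrt (p i * (1 - p i) / hollow_prob p i)) x|
      <= C / Num.sqrt n%:R].
Proof.
move=> K0; have [C1 C10 hC1] := binE_ratio_clt pi01 q01 K0.
pose C2 := C1 + 2 / hollow_prob p i.
have C20 : 0 <= 2 / hollow_prob p i by rewrite divr_ge0 // ltW.
exists (C2 * (2 * i.+1%:R ^+ 2)).
  by rewrite mulr_ge0 ?mulr_ge0 ?exprn_ge0 // addr_ge0.
move=> n i_n; have N0 : 0 < 'C(n, i.+1)%:R :> R by rewrite ltr0n bin_gt0.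
have N1 : 1 <= 'C(n, i.+1)%:R :> R by rewrite ler1n bin_gt0.
have dev0 (A : {set {set 'I_n}}) : 0 <= deviation p i A :> R.
  by rewrite addr_ge0 // invr_ge0 sqrtr_ge0.
have fin (g : {set {set 'I_n}} -> R) : (forall A, g A <= C2 * deviation p i A) ->
    bE (@rate R p n) g <= C2 * (2 * i.+1%:R ^+ 2) / Num.sqrt n%:R.
  move=> gd; apply: (@le_trans _ _ (C2 * bE (@rate R p n) (deviation p i))).
    by rewrite -bEZ; apply: le_bE => //; exact: rate01.
  by rewrite -mulrA ler_wpM2l ?addr_ge0 // Ex_deviation.
have up c (x : R) (A : {set {set 'I_n}}) : 0 <= c -> c <= C2 -> x <= c * deviation p i A ->
    x <= C2 * deviation p i A.
  by move=> c0 cC xd; rewrite (le_trans xd) // ler_wpM2r.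
split.
- apply: fin => A; apply: (up (2 / hollow_prob p i)) => //; first by rewrite lerDr.
  exact: zero_dev.
- rewrite (Ex_level p n (fun h k => (ratio R h k - p i) ^+ 2) i0).
  apply: fin => A; apply: (up (2 / hollow_prob p i)) => //; first by rewrite lerDr.
  exact: binE_ratio_var.
- move=> x xK; rewrite (Ex_level p n (fun h k =>
    (Num.sqrt 'C(n, i.+1)%:R * (ratio R h k - p i) <= x)%R%:R) i0).
  rewrite -[ncdf _ _](bE_cst (@rate R p n)) -bEB.
  apply: le_trans (ler_norm_bE (rate01 p01) _) _; apply: fin => A.
  by apply: (up C1) => //; [rewrite lerDl|exact: hC1].
Qed.

End EstimatorBounds.

(** * The law of the random hypergraph *)

Section FiniteValuedExpectation.
Context (R : realType) d (T : measurableType d) (P : probability T R).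
Context (U : finType) (X : T -> U).
Hypothesis mX : forall u, measurable [set w | X w = u].

Let pmf u := fine (P [set w | X w = u]).

Lemma fin_expectation (g : U -> R) :
  ('E_P[fun w => g (X w)] = (\sum_u pmf u * g u)%:E)%E.
Proof.
pose term u : T -> R := g u \o* \1_[set w | X w = u].
have int u : (\1_[set w | X w = u] : T -> R) \in Lfun P 1.
  by apply/Lfun1_integrable; exact: integrable_indic.
have intt u : term u \in Lfun P 1 by rewrite Lfun_scale.
have -> : (fun w => g (X w)) = \sum_u term u.
  apply/funext => w; rewrite fct_sumE (bigD1 (X w)) //= big1 ?addr0 => [|u uX].
    by rewrite /term /= indicE mem_set // mul1r.
  rewrite /term /= indicE memNset ?mul0r //= => Xu.
  by rewrite Xu eqxx in uX.
rewrite -(big_map term xpredT id) expectation_sum; last first.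
  by move=> _ /mapP[u _ ->]; exact: intt.
rewrite big_map -sumEFin; apply: eq_bigr => u _.
rewrite expectationZl // expectation_indic // mulrC EFinM fineK //.
exact: fin_num_measure.
Qed.

Lemma fin_probability (Q : pred U) :
  (P [set w | Q (X w)] = (\sum_u pmf u * (Q u)%:R)%:E)%E.
Proof.
have mQ : measurable [set w | Q (X w)].
  have -> : [set w | Q (X w)] = \bigcup_(u in [set u | Q u]) [set w | X w = u].
    by apply/seteqP; split => [w Qw|w [u Qu /= ->]] //; exists (X w).
  by apply: fin_bigcup_measurable => // *; exact: finite_finset.
rewrite -expectation_indic // -fin_expectation; congr ('E_P[ _ ])%E.
apply/funext => w; rewrite indicE; congr (_%:R); congr nat_of_bool.
by apply/idP/idP; rewrite inE.
Qed.

End FiniteValuedExpectation.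

(** Sums over supersets determine a function, by induction on the size of the complement. Hence the
    probabilities of containing given families determine the law of the hypergraph. *)
Lemma eq_from_sup_sums (R : realType) (U : finType) (f g : {set U} -> R) :
  (forall F : {set U}, \sum_A f A * (F \subset A)%:R = \sum_A g A * (F \subset A)%:R) ->
  f =1 g.
Proof.
move=> fg F; have [m] := ubnP #|~: F|; elim: m F => // m IH F Fm.
have := fg F; rewrite (bigD1 F) //= [RHS](bigD1 F) //= fintype.subxx !mulr1.
rewrite [X in _ + X = _](eq_bigr (fun A => g A * (F \subset A)%:R)); first exact: addIr.
move=> A AF; have [FA|_] := boolP (F \subset A); last by rewrite !mulr0.
rewrite IH // -ltnS; apply: leq_trans Fm; rewrite ltnS proper_card //.
by rewrite finset.properC finset.properEneq FA eq_sym AF.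
Qed.

Section HypergraphLaw.
Context (R : realType) (p : nat -> R) (n : nat) (d : measure_display).
Context (T : measurableType d) (P : probability T R) (H : T -> {set {set 'I_n}}).
Hypothesis rH : random_hypergraph p P H.

(* [H] completed with the sets of cardinality at most 1, which are irrelevant
   to the random complex. *)
Definition completed (w : T) : {set {set 'I_n}} :=
  [set t : {set 'I_n} | (#|t| <= 1)%N || (t \in H w)]%SET.

Let measurable_mem (t : {set 'I_n}) : measurable [set w | t \in completed w].
Proof.
have [t1|t1] := leqP #|t| 1.
  have -> : [set w | t \in completed w] = setT.
    by apply/seteqP; split => w //= _; rewrite inE t1.
  exact: measurableT.
have -> : [set w | t \in completed w] = [set w | t \in H w].
  by apply/seteqP; split => w /=; rewrite inE leqNgt t1.
exact: rh_measurable rH t t1.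
Qed.

Lemma measurable_completed (A : {set {set 'I_n}}) :
  measurable [set w | completed w = A].
Proof.
have -> : [set w | completed w = A] = \bigcap_(t in [set: {set 'I_n}])
    (if t \in A then [set w | t \in completed w]
     else ~` [set w | t \in completed w]).
  apply/seteqP; split => [w <- t _|w wA] /=.
    by case: ifPn => // /negP.
  apply/finset.setP => t; have := wA t I.
  by case: ifPn => _ /=; [move=> ->|move/negP/negbTE].
apply: fin_bigcap_measurable => [|t _]; first exact: finite_finset.
by case: ifP => _ //; exact: measurableC.
Qed.

(** Independence is assumed for sets of at least two vertices; the other members of [F] lie in
    [completed w] surely and contribute factors 1. *)
Let prob_sup (F : {set {set 'I_n}}) :
  (P [set w | F \subset completed w] = (\prod_(t in F) rate p t)%:E)%E.
Proof.
pose F1 := [set t in F | (1 < #|t|)%N]%SET.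
have -> : [set w | F \subset completed w] = [set w | forall t, t \in F1 -> t \in H w].
  apply/seteqP; split => w /= FH.
    move=> t; rewrite inE => /andP[tF t1].
    by have := fintype.subsetP FH t tF; rewrite inE leqNgt t1.
  apply/fintype.subsetP => t tF; rewrite inE leqNgt.
  by case: (boolP (1 < #|t|)%N) => // t1; apply: FH; rewrite inE tF.
rewrite (rh_independent rH); last by move=> t; rewrite inE => /andP[].
rewrite -prodEFin.
rewrite [RHS](bigID (fun t : {set 'I_n} => (1 < #|t|)%N)) /= muleC.
rewrite [X in _ = (X * _)%E]big1 ?mul1e => [|t /andP[_ /negbTE t1]]; last first.
  by rewrite /rate t1.
apply: eq_big => t; first by rewrite inE.
by rewrite inE => /andP[_ t1]; rewrite (rh_prob rH) // /rate t1.
Qed.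

Lemma prob_completed (A : {set {set 'I_n}}) :
  fine (P [set w | completed w = A]) = bw (@rate R p n) A.
Proof.
move: A; apply: eq_from_sup_sums => F.
have := prob_sup F.
rewrite (fin_probability P measurable_completed (fun A => F \subset A)) => -[->].
by rewrite -bE_sup.
Qed.

Lemma hypergraph_expectation (g : {set {set 'I_n}} -> R) :
  ('E_P[fun w => g (completed w)] = (bE (@rate R p n) g)%:E)%E.
Proof.
rewrite (fin_expectation P measurable_completed); congr (_%:E).
by apply: eq_bigr => A _; rewrite prob_completed.
Qed.

Lemma hypergraph_probability (Q : pred {set {set 'I_n}}) :
  (P [set w | Q (completed w)] = (bE (@rate R p n) (fun A => (Q A)%:R))%:E)%E.
Proof.
rewrite (fin_probability P measurable_completed); congr (_%:E).
by apply: eq_bigr => A _; rewrite prob_completed.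
Qed.

(** Singletons are already in [H w], so completion can add only the empty set, which is never a
    simplex. *)
Lemma phat_completed i w : phat R H i w = estimator R i (completed w).
Proof.
rewrite /phat /estimator /ratio -mleE; congr (mle _ _ _); apply/finset.setP => s; rewrite !inE.
congr (_ && _); apply: eq_forallb => t; rewrite inE.
have [//|t0] := eqVneq t finset.set0.
have [t1|t1] := leqP #|t| 1; last by [].
have /cards1P[v ->] : #|t| == 1%N by rewrite eqn_leq t1 card_gt0.
by rewrite (rh_singleton rH).
Qed.

End HypergraphLaw.

(** * Limits *)

Lemma covariance_hypergraph (R : realType) (p : nat -> R) (n : nat)
    (d : measure_display) (T : measurableType d) (P : probability T R)
    (H : T -> {set {set 'I_n}}) (g h : {set {set 'I_n}} -> R) :
  random_hypergraph p P H ->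
  covariance P (fun w => g (completed H w)) (fun w => h (completed H w)) =
  (bE (@rate R p n) (fun A =>
    (g A - bE (@rate R p n) g) * (h A - bE (@rate R p n) h)))%:E.
Proof.
move=> rH; rewrite covariance.unlock !(hypergraph_expectation rH) /=.
exact: (hypergraph_expectation rH (fun A =>
    (g A - bE (@rate R p n) g) * (h A - bE (@rate R p n) h))).
Qed.

Section Limits.
Context (R : realType).

(** Finiteness is asked for only eventually, since the law of [H n] is prescribed only for
    [n > d]. *)
Lemma cvg_of_near_bound (u : nat -> \bar R) (l : R) :
  (forall e, 0 < e -> \forall n \near \oo,
    exists2 r : R, u n = r%:E & `|r - l| <= e) ->
  u @ \oo --> l%:E.
Proof.
move=> h; apply/fine_cvgP; split.
  by apply: filterS (h 1 ltr01) => n [r -> _].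
apply/cvgrPdist_le => e e0; apply: filterS (h e e0) => n [r eq rl].
by rewrite /= eq /= distrC.
Qed.

Lemma near_div_sqrt (C e : R) : 0 < e ->
  \forall n \near \oo, C / Num.sqrt n%:R <= e.
Proof.
move=> e0.
have [C0|C0] := leP C 0.
  apply: nearW => n; apply: (@le_trans _ _ 0); last exact: ltW.
  by rewrite mulr_le0_ge0 // invr_ge0 sqrtr_ge0.
near=> n.
have n1 : (C / e) ^+ 2 <= n%:R by near: n; exact: nbhs_infty_ger.
have Ce : 0 < C / e by rewrite divr_gt0.
have n0 : 0 < n%:R :> R by apply: lt_le_trans n1; rewrite exprn_gt0.
rewrite ler_pdivrMr ?sqrtr_gt0 // mulrC -ler_pdivrMr //.
rewrite -[leLHS]ger0_norm ?(ltW Ce) // -sqrtr_sqr ler_wsqrtr //.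
Unshelve. all: by end_near. Qed.

(** With m = n %/ k, the power [(1 - q) ^+ m] is at most exp(- q m), and the exponential series
    dominates its term of degree [c.+1]. The spare power of [n] absorbs the square root. *)
Lemma pow_geometric_bound (k c : nat) (q : R) : (0 < k)%N -> 0 < q <= 1 ->
  exists C : R, forall n, (k <= n)%N ->
    n%:R ^+ c * (1 - q) ^+ (n %/ k) <= C / Num.sqrt n%:R.
Proof.
move=> k0 /andP[q0 q1]; pose C : R := (2 * k%:R / q) ^+ c.+1 * c.+1`!%:R.
exists C => n kn; set m := (n %/ k)%N.
have n0 : (0 < n)%N by exact: leq_trans kn.
have m0 : (0 < m)%N by rewrite divn_gt0.
have nR0 : 0 < n%:R :> R by rewrite ltr0n.
(* Rounding down in [n %/ k] costs at most a factor 2 because [k <= n]. *)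
have nkm : n%:R <= 2 * k%:R * m%:R :> R.
  rewrite -!natrM ler_nat; have := divn_eq n k; have := ltn_pmod n k0.
  rewrite -/m; nia.
have qm0 : 0 <= q * m%:R by rewrite mulr_ge0 // ltW.
have geo : (1 - q) ^+ m <= (expR (q * m%:R))^-1.
  rewrite -expRN -mulNr mulrC expRM_natl lerXn2r ?nnegrE ?expR_ge0 ?subr_ge0 //.
  exact: expR_ge1Dx.
have fac0 : 0 < c.+1`!%:R :> R by rewrite ltr0n fact_gt0.
have exp_ge : (q * m%:R) ^+ c.+1 / c.+1`!%:R <= expR (q * m%:R).
  by apply: le_trans (expR_ge1Dxn c qm0); rewrite lerDr.
have key : n%:R ^+ c.+1 * (1 - q) ^+ m <= C.
  apply: (@le_trans _ _ (n%:R ^+ c.+1 * (expR (q * m%:R))^-1)).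
    by rewrite ler_wpM2l // exprn_ge0.
  rewrite ler_pdivrMr ?expR_gt0 //.
  apply: (@le_trans _ _ ((2 * k%:R / q) ^+ c.+1 * (q * m%:R) ^+ c.+1)).
    have E : 2 * k%:R / q * (q * m%:R) = 2 * k%:R * m%:R :> R.
      by field; rewrite gt_eqF.
    by rewrite -exprMn E lerXn2r // nnegrE // !mulr_ge0.
  rewrite /C -[_ * _ * expR _]mulrA ler_wpM2l ?exprn_ge0 ?divr_ge0 ?mulr_ge0 ?(ltW q0) //.
  by rewrite -ler_pdivrMl // mulrC.
have n1 : 1 <= n%:R :> R by rewrite ler1n.
have s0 : 0 < Num.sqrt n%:R :> R by rewrite sqrtr_gt0.
have sn : Num.sqrt n%:R <= n%:R :> R.
  rewrite -[leRHS]ger0_norm // -sqrtr_sqr ler_wsqrtr // expr2.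
  by rewrite ler_peMr // ltW.
rewrite ler_pdivlMr //; apply: le_trans key; rewrite exprSr.
rewrite -!mulrA ler_wpM2l ?exprn_ge0 // [leRHS]mulrC ler_wpM2l //.
by rewrite exprn_ge0 // subr_ge0.
Qed.

Lemma bin_le_exp n k : ('C(n, k) <= n ^ k)%N.
Proof.
elim: k n => [|k IH] n; first by rewrite bin0 expn0.
have [->|n0] := posnP n; first by rewrite bin0n.
apply: (@leq_trans (k.+1 * 'C(n, k.+1))); first exact: leq_pmull.
rewrite -mul_bin_diag expnS leq_mul2l (leq_trans (IH n.-1)) ?orbT //.
by case: (k) => [//|k0]; rewrite leq_exp2r // leq_pred.
Qed.

End Limits.

(** * Assembly of the three limits *)

Local Open Scope ereal_scope.

Theorem theorem1p1 (R : realType) (d : nat) (hd : (1 <= d)%N) (p : nat -> R)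
    (hp : forall i : nat, (1 <= i <= d)%N -> (0 < p i < 1)%R)
    (hp0 : forall i : nat, (d < i)%N -> p i = 0%R)
    (disp : nat -> measure_display)
    (T : forall n : nat, measurableType (disp n))
    (P : forall n : nat, probability (T n) R)
    (H : forall n : nat, T n -> {set {set 'I_n}})
    (hH : forall n : nat, (d < n)%N -> random_hypergraph p (P n) (H n)) :
  (forall i : nat, (1 <= i <= d)%N ->
     (fun n : nat => 'E_(P n)[phat R (H n) i]) @ \oo --> (p i)%:E /\
     (fun n : nat => 'V_(P n)[phat R (H n) i]) @ \oo --> 0) /\
  (forall i j : nat, (1 <= i)%N -> (i < j)%N -> (j <= d)%N ->
     (fun n : nat => covariance (P n) (Wstat (H n) p i) (Wstat (H n) p j))
       @ \oo --> 0) /\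
  (forall i : nat, (1 <= i <= d)%N ->
     (fun n : nat => ereal_sup [set
        `| P n [set w | (Wstat (H n) p i w <= x)%R]
           - normal_cdf (limit_variance p i) x | | x in [set: R]])
       @ \oo --> 0).
Proof.
have p01 k : (0 < k)%N -> (0 <= p k <= 1)%R.
  move=> k0; have [kd|dk] := leqP k d; last by rewrite hp0 // lexx ler01.
  by have /andP[? ?] := hp k (introT andP (conj k0 kd)); rewrite !ltW.
have q0 i : (i <= d)%N -> (0 < hollow_prob p i)%R.
  move=> id; rewrite /hollow_prob big_nat_cond; apply: prodr_gt0 => k /andP[/andP[k1 ki] _].
  by rewrite exprn_gt0 //; have := hp k; rewrite k1 (leq_trans (ltnW ki) id) => /(_ isT) /andP[].
pose Ex n := bE (@rate R p n).
have phatE n i : (d < n)%N -> phat R (H n) i =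
    fun w => estimator R i (completed (H n) w).
  by move=> dn; apply/funext => w; exact: phat_completed (hH n dn) i w.
have WE n i : (d < n)%N -> Wstat (H n) p i =
    fun w => (Num.sqrt 'C(n, i.+1)%:R * (estimator R i (completed (H n) w) - p i))%R.
  by move=> dn; rewrite /Wstat phatE.
have large : \forall n \near \oo, (d < n)%N by exact: nbhs_infty_gt.
split=> [i /andP[i1 id]|].
  have [C C0 hC] := estimator_bounds p01 i1 (hp i (introT andP (conj i1 id))) (q0 i id) (lexx 0%R).
  split; apply: cvg_of_near_bound => e e0.
    near=> n; have dn : (d < n)%N by near: n.
    exists (Ex n (estimator R i)).
      by rewrite phatE // (hypergraph_expectation (hH n dn)).
    have [zero _ _] := hC n (leq_ltn_trans id dn).
    have Cn : (C / Num.sqrt n%:R <= e)%R by near: n; exact: near_div_sqrt.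
    rewrite /Ex Ex_estimator // addrAC subrr sub0r normrN.
    have /andP[pi0 pi1] := p01 i i1.
    have z0 : (0 <= bE (@rate R p n) (fun A => (#|hollow_sets A i| == 0%N)%:R))%R.
      by apply: bE_ge0 => [t|A]; [exact: rate01|].
    rewrite ger0_norm ?mulr_ge0 // (le_trans _ Cn) // (le_trans _ zero) //.
    by rewrite ler_piMl.
  near=> n; have dn : (d < n)%N by near: n.
  exists (Ex n (fun A => (estimator R i A - Ex n (estimator R i)) *
                         (estimator R i A - Ex n (estimator R i))))%R.
    by rewrite /variance phatE // (covariance_hypergraph _ _ (hH n dn)).
  have [_ var _] := hC n (leq_ltn_trans id dn).
  have Cn : (C / Num.sqrt n%:R <= e)%R by near: n; exact: near_div_sqrt.
  rewrite subr0 ger0_norm; last first.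
    apply: bE_ge0 => [t|A]; [exact: rate01|by rewrite -expr2 sqr_ge0].
  rewrite (le_trans _ Cn) // (le_trans _ var) //.
  (* The variance is at most the mean squared error about [p i]; they differ by [(m - p i) ^+ 2]. *)
  set m := Ex n (estimator R i); rewrite -subr_ge0 /Ex -bEB.
  rewrite (eq_bE _ (g' := fun A => (2 * (m - p i)) * estimator R i A + (p i ^+ 2 - m ^+ 2))%R).
    rewrite bED bEZ bE_cst (_ : bE _ _ = m) //; have := sqr_ge0 (m - p i)%R; lra.
  by move=> A; ring.
split=> [i j i1 ij jd|i /andP[i1 id]].
  have j1 : (0 < j)%N by exact: ltn_trans ij.
  have q01 : (0 < hollow_prob p j <= 1)%R.
    by rewrite q0 //; case/andP: (hollow_prob01 p01 j).
  (* The normalizing factors are bounded crudely by [n ^ i.+1] and [n ^ j.+1]; the geometric decay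
     absorbs any power. *)
  have [C hC] := pow_geometric_bound (i.+1 + j.+1) (ltn0Sn j) q01.
  apply: cvg_of_near_bound => e e0.
  near=> n; have dn : (d < n)%N by near: n.
  have Cn : (C / Num.sqrt n%:R <= e)%R by near: n; exact: near_div_sqrt.
  set ai := Num.sqrt 'C(n, i.+1)%:R : R; set aj := Num.sqrt 'C(n, j.+1)%:R : R.
  exists (ai * aj * Ex n (fun A => (estimator R i A - Ex n (estimator R i)) *
                         (estimator R j A - Ex n (estimator R j))))%R.
    rewrite !WE // (covariance_hypergraph (fun A => ai * (estimator R i A - p i))%R
       (fun A => aj * (estimator R j A - p j))%R (hH n dn)).
    congr (_%:E); rewrite /Ex !bEZ !bEB !bE_cst -bEZ; apply: eq_bE => A; ring.
  rewrite subr0 !normrM (ger0_norm (sqrtr_ge0 _)) (ger0_norm (sqrtr_ge0 _)).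
  rewrite (le_trans _ Cn) // (le_trans _ (hC n _)) //; last exact: leq_ltn_trans dn.
  have le_a k : (Num.sqrt 'C(n, k)%:R <= n%:R ^+ k :> R)%R.
    rewrite -natrX (le_trans _ (_ : 'C(n, k)%:R <= _)%R) ?ler_nat ?bin_le_exp //.
    case: 'C(n, k) => [|N]; first by rewrite sqrtr0.
    rewrite -[leRHS]ger0_norm // -sqrtr_sqr ler_wsqrtr // expr2.
    by rewrite ler_peMr // ler1n.
  rewrite exprD -!mulrA ler_pM ?sqrtr_ge0 ?mulr_ge0 ?sqrtr_ge0 // ler_pM ?sqrtr_ge0 //.
  by rewrite (le_trans (Ex_estimator_cov n p01 i1 ij)) // Ex_no_hollow.
have pi01 := hp i (introT andP (conj i1 id)); have /andP[pi0 pi1] := pi01.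
set s := Num.sqrt (p i * (1 - p i) / hollow_prob p i).
have s0 : (0 < s)%R by rewrite sqrtr_gt0 divr_gt0 ?mulr_gt0 ?subr_gt0 ?q0.
have varE : limit_variance p i = (p i * (1 - p i) / hollow_prob p i)%R.
  by rewrite /limit_variance /hollow_prob prodfV.
have normalE x : normal_cdf (limit_variance p i) x = (ncdf s x)%:E.
  by rewrite /normal_cdf varE ncdfE.
pose Fn n x := Ex n (fun A =>
  (Num.sqrt 'C(n, i.+1)%:R * (estimator R i A - p i) <= x)%R%:R).
have PE n x : (d < n)%N ->
    P n [set w | (Wstat (H n) p i w <= x)%R] = (Fn n x)%:E.
  move=> dn; rewrite WE // (hypergraph_probability (hH n dn) (fun A =>
    (Num.sqrt 'C(n, i.+1)%:R * (estimator R i A - p i) <= x)%R)) //.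
have Fn_nd n x y : (x <= y)%R -> (Fn n x <= Fn n y)%R.
  move=> xy; apply: le_bE => [t|A]; first exact: rate01.
  by rewrite ler_nat; case: leP => // /le_trans -> .
have Fn01 n x : (0 <= Fn n x <= 1)%R.
  rewrite -{1}(bE_cst (@rate R p n) 0) -(bE_cst (@rate R p n) 1).
  by apply/andP; split; apply: le_bE => [t|A];
    rewrite ?ler0n ?lern1 ?leq_b1 //; exact: rate01.
apply: cvg_of_near_bound => e e0.
have e2 : (0 < e / 2)%R by rewrite divr_gt0.
have [x0 hx0] := ncdf_Ny s e2; have [x1 hx1] := ncdf_y s e2.
(* Outside [[- K, K]] the normal law has mass at most [e / 2] on each side. *)
pose K := Num.max `|x0|%R `|x1|%R.
have K0 : (0 <= K)%R by rewrite /K le_max normr_ge0.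
have KN : (ncdf s (- K) <= e / 2)%R.
  by apply: hx0; rewrite lerNl /K le_max -normrN ler_norm.
have KP : (1 - e / 2 <= ncdf s K)%R by apply: hx1; rewrite /K le_max ler_norm orbT.
have [C C0 hC] := estimator_bounds p01 i1 pi01 (q0 i id) K0.
near=> n; have dn : (d < n)%N by near: n.
have Cn : (C / Num.sqrt n%:R <= e / 2)%R by near: n; exact: near_div_sqrt.
have [_ _ clt] := hC n (leq_ltn_trans id dn).
have near_cdf x : (- K <= x <= K)%R -> (`|Fn n x - ncdf s x| <= e / 2)%R.
  by move=> xK; apply: le_trans (clt x xK) Cn.
(* Beyond [K] or below [- K], both distribution functions are monotone and within [e] of 1 or 0, by
   comparison with the endpoint. *)
have unif x : (`|Fn n x - ncdf s x| <= e)%R.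
  have /andP[f0 f1] := Fn01 n x; have g0 := ncdf_ge0 s x; have g1 := ncdf_le1 s x.
  have [xK|Kx] := leP x (- K)%R.
    have := Fn_nd n _ _ xK; have := ncdf_nd s0 xK.
    have /near_cdf : (- K <= - K <= K)%R by rewrite lexx /=; lra.
    rewrite !ler_norml; lra.
  have [Kx'|xK] := leP K x.
    have := Fn_nd n _ _ Kx'; have := ncdf_nd s0 Kx'.
    have /near_cdf : (- K <= K <= K)%R by rewrite lexx andbT; lra.
    rewrite !ler_norml; lra.
  have /near_cdf : (- K <= x <= K)%R by rewrite !ltW.
  lra.
set S := ereal_sup _.
have S_ub : S <= e%:E.
  apply: ge_ereal_sup => _ [x _ <-].
  by rewrite PE // normalE -EFinB /= lee_fin.
(* The point 0 shows that the supremum is not -oo. *)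
have S_lb : 0 <= S.
  apply: ereal_sup_ge; exists `|P n [set w | (Wstat (H n) p i w <= 0)%R]
           - normal_cdf (limit_variance p i) 0|; last exact: abse_ge0.
  by exists 0%R.
have S_fin : S \is a fin_num.
  by rewrite ge0_fin_numE // (le_lt_trans S_ub) // ltry.
exists (fine S); first by rewrite fineK.
rewrite subr0 ger0_norm ?fine_ge0 // -lee_fin fineK //.
Unshelve. all: by end_near. Qed.
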